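(* Fix a positive integer $r$ and $\epsilon>0$. There is a constant $\kappa=\kappa(r,\epsilon)>0$, depending only on $r$ and $\epsilon$, and there are deterministic algorithms which, given an integer $n\ge2$, run in time polynomial in $n$ and construct, respectively: (a) $k\le\kappa\ln n$ linear forms $\ell_1,\ldots,\ell_k:\mathbb{R}^n\to\mathbb{R}$ such that in the monomial expansion $\sum_{i=1}^k\ell_i(\mathbf{x})^r=\sum_a\tilde h_{r,a}\mathbf{x}^a$ one has $(1-\epsilon)^r\le\tilde h_{r,a}\le(1+\epsilon)^r$ for all non-negative integer vectors $a=(\alpha_1,\ldots,\alpha_n)$ with $\alpha_1+\cdots+\alpha_n=r$; (b) an integer $k\le\kappa\ln n$ and linear forms $\ell_{ij}:\mathbb{R}^n\to\mathbb{R}$, $1\le i\le k$, $1\le j\le r$, such that $\sum_{i=1}^k\prod_{j=1}^r\ell_{ij}(\mathbf{x})=\sum_I\tilde e_{r,I}\prod_{i\in I}x_i$, where $I$ ranges over the $r$-element subsets of $\{1,\ldots,n\}$, and $(1-\epsilon)^r\le\tilde e_{r,I}\le(1+\epsilon)^r$ for every such $I$.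
   Context: $\mathbf{x}=(x_1,\ldots,x_n)$ and $\mathbf{x}^a=x_1^{\alpha_1}\cdots x_n^{\alpha_n}$ for $a=(\alpha_1,\ldots,\alpha_n)$. A linear form is a homogeneous linear function $\mathbb{R}^n\to\mathbb{R}$. *)

(* Defs.v *)
From HB Require Import structures.
From mathcomp Require Import all_boot all_order all_algebra.
From mathcomp Require Import reals exp.

Set Implicit Arguments.
Unset Strict Implicit.
Unset Printing Implicit Defensive.

Import Order.TTheory GRing.Theory Num.Theory.

(** Deterministic algorithms are structured programs for a random access
    machine with indirect addressing, whose cells hold natural numbers.
    Every elementary instruction and every test costs one step. As the only
    arithmetic is addition and subtraction, cell contents have at most
    (number of steps + O(1)) more bits than the input, so that polynomial time
    on this machine is the same as polynomial time on a Turing machine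
    (Cook and Reckhow). *)

Definition memory := nat -> nat.

Definition update (M : memory) (i v : nat) : memory :=
  fun j => if j == i then v else M j.

Inductive program :=
| Const (i c : nat)                 (* M[i] := c *)
| Plus (i j l : nat)                (* M[i] := M[j] + M[l] *)
| Minus (i j l : nat)               (* M[i] := M[j] - M[l], truncated at 0 *)
| ReadAt (i j : nat)                (* M[i] := M[M[j]] *)
| WriteAt (i j : nat)              (* M[M[i]] := M[j] *)
| Then (P Q : program)
| IfNonzero (i : nat) (P Q : program)
| WhileNonzero (i : nat) (P : program).

(** [exec P M t M']: started in memory [M], the program [P] halts after
    exactly [t] steps in memory [M']. *)
Inductive exec : program -> memory -> nat -> memory -> Prop :=
| exec_const i c M : exec (Const i c) M 1 (update M i c)
| exec_plus i j l M : exec (Plus i j l) M 1 (update M i (M j + M l))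
| exec_minus i j l M : exec (Minus i j l) M 1 (update M i (M j - M l))
| exec_read_at i j M : exec (ReadAt i j) M 1 (update M i (M (M j)))
| exec_write_at i j M : exec (WriteAt i j) M 1 (update M (M i) (M j))
| exec_then P Q M s M' t M'' :
    exec P M s M' -> exec Q M' t M'' -> exec (Then P Q) M (s + t) M''
| exec_if_true i P Q M t M' :
    M i <> 0 -> exec P M t M' -> exec (IfNonzero i P Q) M t.+1 M'
| exec_if_false i P Q M t M' :
    M i = 0 -> exec Q M t M' -> exec (IfNonzero i P Q) M t.+1 M'
| exec_while_true i P M s M' t M'' :
    M i <> 0 -> exec P M s M' -> exec (WhileNonzero i P) M' t M'' ->
    exec (WhileNonzero i P) M (s + t).+1 M''
| exec_while_false i P M :
    M i = 0 -> exec (WhileNonzero i P) M 1 M.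

(** The input [n] is in cell 0, all other cells being 0. *)
Definition input (n : nat) : memory := update (fun=> 0) 0 n.

(** One program, and one polynomial time bound, for all [n >= 2]. The final
    memory is unique because the machine is deterministic. *)
Definition constructs_in_polytime (P : program)
    (correct : nat -> memory -> Prop) : Prop :=
  exists c d : nat, forall n, 2 <= n ->
    exists t M, [/\ exec P (input n) t M, t <= c * n ^ d & correct n M].

(** Output convention: on halting, cell 0 contains the number [k], and cell 1
    contains the address of an array of rational numbers. Each entry takes
    three consecutive cells [u], [v], [w], standing for (u - v) / (w + 1);
    every rational number is of this form. *)
Definition output_number (M : memory) : nat := M 0.

Local Open Scope ring_scope.

Definition output_entry (R : realType) (M : memory) (q : nat) : R :=
  let p := (M 1 + 3 * q)%N in
  ((M p)%:R - (M p.+1)%:R) / (M p.+2).+1%:R.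

(** The array lists the [n] coefficients of the first linear form, then those
    of the second one, and so on; this is the form of index [q]. *)
Definition output_form (R : realType) (n : nat) (M : memory) (q : nat)
    (x : 'rV[R]_n) : R :=
  \sum_(m < n) output_entry R M (q * n + m) * x 0 m.

(* Main.v *)
(** Only O(ln n) columns are affordable, so the coefficient vectors cannot range
    over an explicit r-wise independent family. Instead each coordinate m
    receives a word of k = A T^r letters, T^r being about log_2 n, chosen
    greedily as in the Gilbert-Varshamov bound: the new word must split almost
    evenly over the alphabet every set of columns cut out by at most r - 1 earlier
    letters. By a Chernoff bound a bad word has probability exponentially small in
    k, while there are only polynomially many sets of columns and polynomially
    many words; hence a good word exists and brute force finds it. Consequently
    any r of the words look, column by column, like independent uniform letters.

    For (a), letters are mapped to a finite law whose moments are close to those of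
    the exponential law, namely the factorials, which cancel the multinomial
    coefficients. For (b) there are r letters, and the j-th form of a column
    collects the coordinates whose letter is j, so that the products see exactly
    the r-subsets whose letters are distinct (color coding). *)
Require Import Defs.
From HB Require Import structures.
From mathcomp Require Import all_boot all_order all_algebra.
From mathcomp Require Import reals exp.
From mathcomp Require Import zify ring lra.

Set Implicit Arguments.
Unset Strict Implicit.
Unset Printing Implicit Defensive.

Import Order.TTheory GRing.Theory Num.Theory.

(** The machine outputs rational coefficients, while averaging over the k columns has to be spread
    over r linear factors, which asks for an r-th root. Hence the shape of k: with T just above the
    r-th root of log_2 n and A = r!^(r-1) B^r, one has r! k = (r! B T)^r, so dividing each
    coefficient by r! B T normalises exactly. The factor r! is the numerator of the multinomial
    coefficient in (a) and the number of orderings of an r-subset in (b).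

    The real number eps reaches the programs only through integers fixed in advance: a rational
    scale p/q, an accuracy D and a finite table of letters. The scale cannot always be 1: for even r
    and eps > 2 the lower bound (1 - eps)^r exceeds 1.

    The programs are not written by hand but obtained from closure properties of a class of
    functions. Values are bounded along with running times, since iterating a polynomial bound does
    not give a polynomial one. *)

(** * Polynomial growth bounds *)

Definition polyn (F : nat -> nat) := exists e, forall b, F b <= (b + 2) ^ e.

Lemma polyn_le (F F' : nat -> nat) :
  (forall b, F' b <= F b) -> polyn F -> polyn F'.
Proof. by move=> le [e He]; exists e => b; apply: leq_trans (le b) (He b). Qed.

Lemma expn_mono m n e : m <= n -> m ^ e <= n ^ e.
Proof. by move=> mn; case: e => // e; rewrite leq_exp2r. Qed.

(** The base [b + 2] is at least 2 even at b = 0, so the exponent alone absorbs constants and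
    sums. *)
Lemma polyn_cst c : polyn (fun=> c).
Proof.
exists c => b; apply: leq_trans (ltnW (ltn_expl c (isT : 1 < 2))) _.
by apply: expn_mono; rewrite leq_addl.
Qed.

Lemma polyn_id : polyn id.
Proof. by exists 1 => b; rewrite expn1 leq_addr. Qed.

Lemma polyn_mul F G : polyn F -> polyn G -> polyn (fun b => F b * G b).
Proof.
move=> [e He] [f Hf]; exists (e + f) => b; rewrite expnD; exact: leq_mul.
Qed.

Lemma polyn_add F G : polyn F -> polyn G -> polyn (fun b => F b + G b).
Proof.
move=> [e He] [f Hf]; exists (e + f + 1) => b.
have x0 : 0 < b + 2 by rewrite addn2.
have le1 : F b <= (b + 2) ^ (e + f).
  by apply: leq_trans (He b) _; rewrite leq_pexp2l ?leq_addr.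
have le2 : G b <= (b + 2) ^ (e + f).
  by apply: leq_trans (Hf b) _; rewrite leq_pexp2l ?leq_addl.
apply: leq_trans (leq_add le1 le2) _.
by rewrite addnn -mul2n (expnD _ _ 1) mulnC leq_mul2l expn1 leq_addl orbT.
Qed.

Lemma polyn_comp F G : polyn F -> polyn G -> polyn (fun b => F (G b)).
Proof.
move=> [e He] [f Hf].
have [h Hh] := polyn_add (ex_intro _ f (fun b => leqnn _) : polyn (fun b => (b + 2) ^ f))
   (polyn_cst 2).
exists (h * e) => b; apply: leq_trans (He _) _; rewrite expnM; apply: expn_mono.
by apply: leq_trans (Hh b); rewrite leq_add2r.
Qed.

Lemma polyn_exp F e : polyn F -> polyn (fun b => F b ^ e).
Proof.
move=> pF; elim: e => [|e IH]; first exact: (polyn_cst 1).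
by apply: polyn_le (polyn_mul pF IH) => b; rewrite expnS.
Qed.

Ltac pol := repeat first [assumption | apply: polyn_cst | apply: polyn_id
  | apply: polyn_add | apply: polyn_mul | apply: polyn_exp].

(** * Total correctness with an upper bound on time *)

Definition runs P M T (Post : memory -> Prop) :=
  exists t M', [/\ exec P M t M', t <= T & Post M'].

Lemma runs_then P Q M s t (Post1 Post2 : memory -> Prop) :
  runs P M s Post1 -> (forall M', Post1 M' -> runs Q M' t Post2) ->
  runs (Then P Q) M (s + t) Post2.
Proof.
move=> [s' [M' [ex1 le1 post1]]] /(_ M' post1) [t' [M'' [ex2 le2 post2]]].
exists (s' + t'), M''; split=> //; [exact: exec_then ex1 ex2 | exact: leq_add].
Qed.

Lemma runs_weak P M s t (Post1 Post2 : memory -> Prop) :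
  runs P M s Post1 -> s <= t -> (forall M', Post1 M' -> Post2 M') ->
  runs P M t Post2.
Proof.
move=> [s' [M' [ex1 le1 post1]]] st post; exists s', M'; split=> //.
  exact: leq_trans le1 st.
exact: post.
Qed.

Lemma runs_const i c M (Post : memory -> Prop) :
  Post (update M i c) -> runs (Const i c) M 1 Post.
Proof. by exists 1, (update M i c); split=> //; constructor. Qed.

Lemma runs_plus i j l M (Post : memory -> Prop) :
  Post (update M i (M j + M l)) -> runs (Plus i j l) M 1 Post.
Proof. by exists 1, (update M i (M j + M l)); split=> //; constructor. Qed.

Lemma runs_minus i j l M (Post : memory -> Prop) :
  Post (update M i (M j - M l)) -> runs (Minus i j l) M 1 Post.
Proof. by exists 1, (update M i (M j - M l)); split=> //; constructor. Qed.

Lemma runs_read i j M (Post : memory -> Prop) :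
  Post (update M i (M (M j))) -> runs (ReadAt i j) M 1 Post.
Proof. by exists 1, (update M i (M (M j))); split=> //; constructor. Qed.

Lemma runs_write i j M (Post : memory -> Prop) :
  Post (update M (M i) (M j)) -> runs (WriteAt i j) M 1 Post.
Proof. by exists 1, (update M (M i) (M j)); split=> //; constructor. Qed.

(* [Inv m] is the invariant when [m] iterations remain. *)
Lemma runs_while i P T N (Inv : nat -> memory -> Prop) (Post : memory -> Prop) :
  (forall m M, m < N -> Inv m.+1 M -> M i <> 0 /\ runs P M T (Inv m)) ->
  (forall M, Inv 0 M -> M i = 0 /\ Post M) ->
  forall M, Inv N M -> runs (WhileNonzero i P) M (N * T.+1 + 1) Post.
Proof.
move=> step fin; elim: N step => [|N IH] step M inv.
  have [M0 post] := fin _ inv; exists 1, M; split=> //; exact: exec_while_false.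
have [M0 [s [M' [ex1 le1 inv']]]] := step N M (ltnSn N) inv.
have step' m M0' : m < N -> Inv m.+1 M0' -> M0' i <> 0 /\ runs P M0' T (Inv m).
  by move=> mN; apply: step; apply: leq_trans mN _.
have [t [M'' [ex2 le2 post]]] := IH step' M' inv'.
exists (s + t).+1, M''; split=> //; first exact: exec_while_true ex1 ex2.
by rewrite mulSn; lia.
Qed.

(** * Functions computable in polynomial time *)

Definition vars (G : Type) := seq (G -> nat).

Definition within (G : Type) (vs : vars G) (H : G -> memory) (b : nat) (g : G) :=
  (forall i, nth (fun=> 0) vs i g <= b) /\ (forall a, H g a <= b).

Definition loaded (G : Type) (vs : vars G) (H : G -> memory)
    (rho : nat -> nat) (W : nat) (g : G) (M : memory) :=
  (forall i, i < size vs -> M (rho i) = nth (fun=> 0) vs i g) /\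
  (forall a, M (W + a) = H g a).

(* A function of a context [g] is computable if, wherever the variables sit
   below register [d] and the heap sits at address [W], some program leaves its
   value in register [d], modifying only scratch registers between [d] and [W],
   with value and time polynomial in the largest number of the context. *)
Definition computable (G : Type) (vs : vars G) (H : G -> memory) (f : G -> nat) :=
  exists w F, [/\ polyn F,
    forall g b, within vs H b g -> f g <= F b &
    forall rho d W, (forall i, i < size vs -> rho i < d) -> d + w <= W ->
    exists P, forall g b M, within vs H b g -> loaded vs H rho W g M ->
      runs P M (F b) (fun M' => M' d = f g /\
        forall j, j < d \/ W <= j -> M' j = M j)].

Lemma eq_comp (G : Type) (vs : vars G) H (f f' : G -> nat) :
  f =1 f' -> computable vs H f -> computable vs H f'.
Proof.
move=> eqf [w [F [pF bF cF]]]; exists w, F; split=> // [g b wi|rho d W rd dW].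
  by rewrite -eqf; apply: bF.
have [P HP] := cF rho d W rd dW; exists P => g b M wi lo.
by rewrite -eqf; apply: HP.
Qed.

Ltac upd := rewrite /update; repeat (case: eqP => ?); try lia.

Lemma loaded_frame (G : Type) (vs : vars G) H rho W d g M M' :
  (forall i, i < size vs -> rho i < d) ->
  (forall j, j < d \/ W <= j -> M' j = M j) ->
  loaded vs H rho W g M -> loaded vs H rho W g M'.
Proof.
move=> rd eqM [l1 l2]; split=> [i ilt|a].
  by rewrite eqM ?l1 //; left; apply: rd.
by rewrite eqM ?l2 //; right; rewrite leq_addr.
Qed.

Lemma comp_cst (G : Type) (vs : vars G) H c : computable vs H (fun=> c).
Proof.
exists 1, (fun=> c + 1); split=> [|g b _|rho d W rd dW]; first by pol.
  by rewrite leq_addr.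
exists (Const d c) => g b M wi lo.
apply: runs_weak (_ : 1 <= c + 1) (fun M' x => x); last by rewrite leq_addl.
by apply: runs_const; split=> [|j jd]; upd.
Qed.

Lemma comp_var (G : Type) (vs : vars G) H i :
  computable vs H (nth (fun=> 0) vs i).
Proof.
case: (ltnP i (size vs)) => ilt; last first.
  by rewrite nth_default //; apply: comp_cst.
exists 2, (fun b => b + 2); split=> [|g b wi|rho d W rd dW]; first by pol.
  by apply: leq_trans (wi.1 i) _; rewrite leq_addr.
(* No instruction copies a register; a zero in [d.+1] is added instead. *)
exists (Then (Const d.+1 0) (Plus d (rho i) d.+1)) => g b M wi lo.
have rid := rd i ilt.
apply: runs_weak (_ : 1 + 1 <= b + 2) (fun M' x => x); last by rewrite leq_addl.
apply: runs_then (fun M' => M' = update M d.+1 0) _ _ _; first exact: runs_const.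
move=> _ ->; apply: runs_plus; split=> [|j jd]; last by upd.
by rewrite -lo.1 //; upd.
Qed.

Lemma comp_bin (G : Type) (vs : vars G) H (op : nat -> nat -> nat)
    (I : nat -> nat -> nat -> program) f g :
  (forall a b, op a b <= a + b) ->
  (forall i j l M (Post : memory -> Prop),
     Post (update M i (op (M j) (M l))) -> runs (I i j l) M 1 Post) ->
  computable vs H f -> computable vs H g -> computable vs H (fun x => op (f x) (g x)).
Proof.
move=> op_le I_ok [wf [F [pF bF cF]]] [wg [E [pE bE cE]]].
exists (wf + wg + 2), (fun b => F b + E b + 1).
split=> [|x b wi|rho d W rd dW]; first by pol.
  by have := op_le (f x) (g x); have := bF x b wi; have := bE x b wi; lia.
have [Pf HPf] := cF rho d W rd ltac:(lia).
have [Pg HPg] := cE rho d.+1 W (fun i ilt => ltnW (rd i ilt)) ltac:(lia).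
exists (Then Pf (Then Pg (I d d d.+1))) => x b M wi lo.
rewrite -addnA; apply: runs_then (HPf x b M wi lo) _ => M1 [M1d M1j].
have lo1 := loaded_frame rd M1j lo.
apply: runs_then (HPg x b M1 wi lo1) _ => M2 [M2d M2j].
apply: I_ok; split=> [|j jd]; upd.
- by rewrite M2d M2j ?M1d //; left.
- by rewrite M2j ?M1j //; lia.
Qed.

Lemma comp_add (G : Type) (vs : vars G) H f g :
  computable vs H f -> computable vs H g -> computable vs H (fun x => f x + g x).
Proof.
by apply: (@comp_bin _ _ _ addn Plus) => // i j l M Post post; apply: runs_plus.
Qed.

Lemma comp_sub (G : Type) (vs : vars G) H f g :
  computable vs H f -> computable vs H g -> computable vs H (fun x => f x - g x).
Proof.
apply: (@comp_bin _ _ _ subn Minus) => [a b|i j l M Post post].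
  by apply: leq_trans (leq_subr _ _) _; rewrite leq_addr.
exact: runs_minus.
Qed.

Lemma comp_get (G : Type) (vs : vars G) H f :
  computable vs H f -> computable vs H (fun x => H x (f x)).
Proof.
move=> [w [F [pF bF cF]]]; exists (w + 2), (fun b => F b + 3 + b).
split=> [|x b wi|rho d W rd dW]; first by pol.
  by apply: leq_trans (wi.2 _) _; rewrite leq_addl.
have [P HP] := cF rho d W rd ltac:(lia).
exists (Then P (Then (Const d.+1 W) (Then (Plus d d d.+1) (ReadAt d d)))) => x b M wi lo.
apply: runs_weak (_ : F b + (1 + (1 + 1)) <= _) (fun M' x => x); last by lia.
apply: runs_then (HP x b M wi lo) _ => M1 [M1d M1j].
apply: (runs_then (Post1 := fun M' => M' = update M1 d.+1 W)); first exact: runs_const.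
move=> _ ->.
apply: (runs_then (Post1 := fun M' => M' = update (update M1 d.+1 W) d (M1 d + W))).
  by apply: runs_plus; congr (update _ _ _); upd.
move=> _ ->; apply: runs_read; split=> [|j jd].
  have -> : update (update M1 d.+1 W) d (M1 d + W) d = W + f x by rewrite M1d; upd.
  by upd; rewrite M1j ?lo.2 //; lia.
by upd; rewrite M1j.
Qed.

(** Contexts grow as nested pairs with the newest variable at index 0, as with de Bruijn indices;
    [cons_reg] is the matching register assignment. *)
Definition ext (G : Type) (vs : vars G) : vars (G * nat) :=
  snd :: [seq (fun p => v p.1) | v <- vs].

Lemma nth_ext (G : Type) (vs : vars G) i p :
  nth (fun=> 0) (ext vs) i p = if i is j.+1 then nth (fun=> 0) vs j p.1 else p.2.
Proof.
case: i => //= j; case: (ltnP j (size vs)) => jlt; first by rewrite (nth_map (fun=> 0)).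
by rewrite !nth_default ?size_map.
Qed.

Lemma within_ext (G : Type) (vs : vars G) H b p :
  within vs H b p.1 -> p.2 <= b -> within (ext vs) (fun p => H p.1) b p.
Proof. by move=> [w1 w2] pb; split=> // -[|j]; rewrite nth_ext. Qed.

Definition cons_reg (rho : nat -> nat) (d i : nat) := if i is j.+1 then rho j else d.

Lemma loaded_ext (G : Type) (vs : vars G) H rho d W p M :
  loaded vs H rho W p.1 M -> M d = p.2 ->
  loaded (ext vs) (fun p => H p.1) (cons_reg rho d) W p M.
Proof.
move=> [l1 l2] Md; split=> // -[|j]; rewrite nth_ext //= ltnS size_map; exact: l1.
Qed.

Lemma comp_weak (G : Type) (vs : vars G) H f :
  computable vs H f -> computable (ext vs) (fun p => H p.1) (fun p => f p.1).
Proof.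
move=> [w [F [pF bF cF]]]; exists w, F.
have wi_ext p b : within (ext vs) (fun p => H p.1) b p -> within vs H b p.1.
  by move=> [w1 w2]; split=> // i; move: (w1 i.+1); rewrite nth_ext.
split=> [//|p b /wi_ext|rho d W rd dW]; first exact: bF.
have [|P HP] := cF (fun i => rho i.+1) d W _ dW.
  by move=> i ilt; apply: rd; rewrite /= size_map.
exists P => p b M /wi_ext wi [l1 l2]; apply: HP => //; split=> // i ilt.
by rewrite l1 ?nth_ext //= size_map.
Qed.

Lemma within_le (G : Type) (vs : vars G) H b b' g :
  b <= b' -> within vs H b g -> within vs H b' g.
Proof.
by move=> bb [w1 w2]; split=> i; [apply: leq_trans (w1 i) bb | apply: leq_trans (w2 i) bb].
Qed.

(** The bound [B] on all intermediate values has to be supplied: the bound of one step composed [N]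
    times need not be polynomial. Given [B], every step runs in a context bounded by
    [b + FN b + B b]. *)
Lemma comp_iteri (G : Type) (vs : vars G) H N (s : G -> nat -> nat -> nat) z B :
  polyn B ->
  (forall g b i, within vs H b g -> i <= N g -> iteri i (s g) (z g) <= B b) ->
  computable vs H N -> computable vs H z ->
  computable (ext (ext vs)) (fun p => H p.1.1) (fun p => s p.1.1 p.1.2 p.2) ->
  computable vs H (fun g => iteri (N g) (s g) (z g)).
Proof.
move=> pB bB [wN [FN [pFN bN cN]]] [wz [Fz [pFz bz cz]]] [ws [Fs [pFs bs cs]]].
pose b' b := b + FN b + B b.
have pb' : polyn b' by pol.
exists (wN + wz + ws + 6), (fun b => B b + Fz b + FN b + 5 + FN b * (Fs (b' b) + 5)).
split=> [|g b wi|rho d W rd dW].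
- by pol; apply: polyn_comp.
- by apply: leq_trans (bB g b _ wi (leqnn _)) _; lia.
have [Pz HPz] := cz rho d W rd ltac:(lia).
have [PN HPN] := cN rho d.+1 W (fun i ilt => ltnW (rd i ilt)) ltac:(lia).
(* Register [d] is the accumulator, [d.+1] the iterations left, [d.+2] the index, [d.+3] the
   constant 1; the step works from [d.+4] on. *)
pose rho' := cons_reg (cons_reg rho d.+2) d.
have rd' i : i < size (ext (ext vs)) -> rho' i < d.+4.
  rewrite /= !size_map; case: i => [|[|i]] //= ilt; first lia.
  by have := rd i ilt; lia.
have [Ps HPs] := cs rho' d.+4 W rd' ltac:(lia).
pose body := Then Ps (Then (Const (d + 5) 0) (Then (Plus d d.+4 (d + 5))
  (Then (Plus d.+2 d.+2 d.+3) (Minus d.+1 d.+1 d.+3)))).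
exists (Then Pz (Then PN (Then (Const d.+2 0) (Then (Const d.+3 1)
  (WhileNonzero d.+1 body))))) => g b M wi lo.
apply: (@runs_weak _ _ (Fz b + (FN b + (1 + (1 + (N g * (Fs (b' b) + 4).+1 + 1))))))
  (_ : _ <= _) (fun M' x => x); last first.
  have : N g * (Fs (b' b) + 4).+1 <= FN b * (Fs (b' b) + 5).
    by apply: leq_mul; [apply: bN | lia].
  by lia.
apply: runs_then (HPz g b M wi lo) _ => M1 [M1d M1j].
have lo1 := loaded_frame rd M1j lo.
apply: runs_then (HPN g b M1 wi lo1) _ => M2 [M2d M2j].
apply: (runs_then (Post1 := fun M' => M' = update M2 d.+2 0)); first exact: runs_const.
move=> _ ->.
apply: (runs_then (Post1 := fun M' => M' = update (update M2 d.+2 0) d.+3 1)).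
  exact: runs_const.
move=> _ ->.
pose Inv m (M' : memory) := [/\ m <= N g, M' d.+1 = m, M' d.+2 = N g - m,
   M' d.+3 = 1 & M' d = iteri (N g - m) (s g) (z g) /\
   forall j, j < d \/ W <= j -> M' j = M j].
apply: (@runs_while _ _ _ _ Inv); last first.
- split; [exact: leqnn | by upd | by upd | by upd | split].
    by rewrite subnn /= -M1d -M2j; [upd | left].
  by move=> j jd; upd; rewrite M2j ?M1j //; lia.
- move=> M' [_ -> _ _ [M'd M'j]]; split=> //; split=> //.
  by rewrite M'd subn0.
move=> m M' mN [mN' i1 i2 i3 [i4 i5]]; split; first by rewrite i1.
have wi' : within (ext (ext vs)) (fun p => H p.1.1) (b' b)
    ((g, N g - m.+1), iteri (N g - m.+1) (s g) (z g)).
  have bNg := bN g b wi.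
  refine (@within_ext _ (ext vs) (fun p => H p.1) (b' b) (_, _) _ _).
    refine (@within_ext _ vs H (b' b) (g, N g - m.+1) _ _) => /=.
      by apply: within_le wi; rewrite /b'; lia.
    by rewrite /b'; lia.
  by rewrite /=; have := bB g b (N g - m.+1) wi (leq_subr _ _); rewrite /b'; lia.
have lo' : loaded (ext (ext vs)) (fun p => H p.1.1) rho' W
    ((g, N g - m.+1), iteri (N g - m.+1) (s g) (z g)) M'.
  refine (@loaded_ext _ (ext vs) (fun p => H p.1) (cons_reg rho d.+2) d W
    ((g, N g - m.+1), iteri (N g - m.+1) (s g) (z g)) M' _ i4).
  refine (@loaded_ext _ vs H rho d.+2 W (g, N g - m.+1) M' _ i2).
  exact: loaded_frame rd i5 lo.
apply: (@runs_weak _ _ (Fs (b' b) + (1 + (1 + (1 + 1)))))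
  (_ : _ <= _) (fun M' x => x); last by lia.
apply: runs_then (HPs _ _ _ wi' lo') _ => M3 [M3d M3j] /=.
apply: (runs_then (Post1 := fun M' => M' = update M3 (d + 5) 0)); first exact: runs_const.
move=> _ ->.
pose M4 := update (update M3 (d + 5) 0) d (M3 d.+4).
apply: (runs_then (Post1 := fun M' => M' = M4)).
  by apply: runs_plus; congr (update _ _ _); upd.
move=> _ ->.
pose M5 := update M4 d.+2 (M3 d.+2 + 1).
apply: (runs_then (Post1 := fun M' => M' = M5)).
  apply: runs_plus; congr (update _ _ _).
  by rewrite /M4; upd; rewrite (M3j d.+3) ?i3 //; lia.
move=> _ ->; apply: runs_minus.
have e1 : M3 d.+1 = m.+1 by rewrite M3j ?i1 //; lia.
have e2 : M3 d.+2 = N g - m.+1 by rewrite M3j ?i2 //; lia.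
have e3 : M3 d.+3 = 1 by rewrite M3j ?i3 //; lia.
split; first by lia.
- by rewrite /M5 /M4; upd; rewrite e1 e3 subn1.
- by rewrite /M5 /M4; upd; rewrite e2; lia.
- by rewrite /M5 /M4; upd.
have NE : N g - m = (N g - m.+1).+1 by lia.
split; first by rewrite /M5 /M4; upd; rewrite M3d NE.
by move=> j jd; rewrite /M5 /M4; upd; rewrite M3j ?i5 //; lia.
Qed.

Lemma comp_sum (G : Type) (vs : vars G) H N (h : G -> nat -> nat) :
  computable vs H N -> computable (ext vs) (fun p => H p.1) (fun p => h p.1 p.2) ->
  computable vs H (fun g => \sum_(0 <= i < N g) h g i).
Proof.
move=> cN ch.
have iteriE g n : iteri n (fun i a => a + h g i) 0 = \sum_(0 <= i < n) h g i.
  by elim: n => [|n IH] /=; [rewrite big_nil | rewrite big_nat_recr //= IH].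
have [_ [FN [pFN bN _]]] := cN; have [_ [Fh [pFh bh _]]] := ch.
apply: eq_comp (fun g => iteriE g (N g)) _.
apply: (@comp_iteri _ _ _ _ (fun g i a => a + h g i) _ (fun b => FN b * Fh (b + FN b))).
- by pol; apply: polyn_comp; pol.
- move=> g b i wi iN; rewrite iteriE.
  apply: leq_trans (_ : \sum_(0 <= j < i) Fh (b + FN b) <= _).
    rewrite !big_nat; apply: leq_sum => j /andP[_ ji].
    apply: (bh (g, j)); refine (@within_ext _ vs H _ (g, j) _ _) => /=.
      by apply: within_le wi; rewrite leq_addr.
    by have := bN g b wi; lia.
  rewrite sum_nat_const_nat subn0 leq_mul2r.
  by rewrite (leq_trans iN) ?orbT // bN.
- exact: cN.
- exact: comp_cst.
apply: comp_add; first exact: (comp_var _ _ 0).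
exact: (comp_weak ch).
Qed.

Lemma comp_S (G : Type) (vs : vars G) H f :
  computable vs H f -> computable vs H (fun x => (f x).+1).
Proof.
move=> cf; apply: (@eq_comp _ _ _ (fun x => f x + 1)) => [x|]; first exact: addn1.
by apply: (comp_add cf _); apply: comp_cst.
Qed.

Lemma comp_mul (G : Type) (vs : vars G) H f g :
  computable vs H f -> computable vs H g -> computable vs H (fun x => f x * g x).
Proof.
move=> cf cg; apply: (@eq_comp _ _ _ (fun x => \sum_(0 <= i < f x) g x)) => [x|].
  by rewrite sum_nat_const_nat subn0.
exact: comp_sum cf (comp_weak cg).
Qed.

Lemma comp_expc (G : Type) (vs : vars G) H f e :
  computable vs H f -> computable vs H (fun x => f x ^ e).
Proof.
move=> cf; elim: e => [|e IH]; first exact: (comp_cst _ _ 1).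
by apply: eq_comp (comp_mul cf IH) => x; rewrite expnS.
Qed.

Definition compb (G : Type) (vs : vars G) (H : G -> memory) (p : G -> bool) :=
  computable vs H (fun x => nat_of_bool (p x)).

Lemma compb_leq (G : Type) (vs : vars G) H f g :
  computable vs H f -> computable vs H g -> compb vs H (fun x => f x <= g x).
Proof.
move=> cf cg; apply: eq_comp (comp_sub (comp_cst _ _ 1) (comp_sub cf cg)) => x.
by rewrite /=; case: leqP => /=; lia.
Qed.

Lemma compb_and (G : Type) (vs : vars G) H p q :
  compb vs H p -> compb vs H q -> compb vs H (fun x => p x && q x).
Proof.
move=> cp cq; apply: eq_comp (comp_mul cp cq) => x.
by rewrite /=; case: (p x); case: (q x).
Qed.

Lemma compb_neg (G : Type) (vs : vars G) H p :
  compb vs H p -> compb vs H (fun x => ~~ p x).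
Proof.
move=> cp; apply: eq_comp (comp_sub (comp_cst _ _ 1) cp) => x.
by rewrite /=; case: (p x).
Qed.

Lemma compb_or (G : Type) (vs : vars G) H p q :
  compb vs H p -> compb vs H q -> compb vs H (fun x => p x || q x).
Proof.
move=> cp cq; apply: eq_comp (compb_neg (compb_and (compb_neg cp) (compb_neg cq))) => x.
by rewrite /= negb_and !negbK.
Qed.

Lemma compb_eq (G : Type) (vs : vars G) H f g :
  computable vs H f -> computable vs H g -> compb vs H (fun x => f x == g x).
Proof.
move=> cf cg; apply: eq_comp (compb_and (compb_leq cf cg) (compb_leq cg cf)) => x.
by rewrite /= eqn_leq.
Qed.

Lemma comp_if (G : Type) (vs : vars G) H p f g :
  compb vs H p -> computable vs H f -> computable vs H g ->
  computable vs H (fun x => if p x then f x else g x).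
Proof.
move=> cp cf cg.
apply: eq_comp (comp_add (comp_mul cp cf) (comp_mul (compb_neg cp) cg)) => x.
by rewrite /=; case: (p x); rewrite /= ?mul1n ?mul0n ?addn0.
Qed.

Lemma sum_ltn_nat m d : d <= m -> \sum_(0 <= i < m) (i < d) = d.
Proof.
elim: m d => [|m IH] d dm; first by rewrite big_nil; lia.
rewrite big_nat_recr //=; case: (ltnP m d) => md; last by rewrite addn0 IH.
rewrite (eq_big_nat _ _ (F2 := fun i => nat_of_bool (i < m))); last first.
  by move=> i /andP[_ im]; rewrite im (ltn_trans im).
by rewrite IH //; lia.
Qed.

(** The quotient counts the positive multiples of [g x] up to [f x]. For [g x = 0] all would count,
    whereas [%/] returns 0, hence the test. *)
Lemma comp_divn (G : Type) (vs : vars G) H f g :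
  computable vs H f -> computable vs H g -> computable vs H (fun x => f x %/ g x).
Proof.
move=> cf cg.
apply: (@eq_comp _ _ _ (fun x => if g x == 0 then 0 else
  \sum_(0 <= i < f x) (i.+1 * g x <= f x))) => [x|]; last first.
  apply: comp_if; [exact: compb_eq cg (comp_cst _ _ 0) | exact: comp_cst |].
  apply: (comp_sum cf _); apply: compb_leq; last exact: comp_weak cf.
  by apply: (comp_mul _ (comp_weak cg)); apply: comp_S; exact: (comp_var _ _ 0).
case: eqP => [->|/eqP g0]; first by rewrite divn0.
rewrite (eq_bigr (fun i => nat_of_bool (i < f x %/ g x))); last first.
  by move=> i _; rewrite leq_divRL ?lt0n.
exact: sum_ltn_nat (leq_div _ _).
Qed.

Lemma comp_modn (G : Type) (vs : vars G) H f g :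
  computable vs H f -> computable vs H g -> computable vs H (fun x => f x %% g x).
Proof.
move=> cf cg.
apply: eq_comp (comp_sub cf (comp_mul (comp_divn cf cg) cg)) => x /=.
by rewrite {1}(divn_eq (f x) (g x)) addKn.
Qed.

Lemma compb_all (G : Type) (vs : vars G) H N (p : G -> nat -> bool) :
  computable vs H N -> compb (ext vs) (fun x => H x.1) (fun x => p x.1 x.2) ->
  compb vs H (fun x => all (p x) (iota 0 (N x))).
Proof.
move=> cN cp.
apply: (@eq_comp _ _ _ (fun x => 1 - \sum_(0 <= i < N x) ~~ p x i)) => [x|]; last first.
  apply: comp_sub; first exact: comp_cst.
  exact: comp_sum cN (compb_neg cp).
elim: (N x) => [|m IH]; first by rewrite big_nil.
rewrite big_nat_recr // -[in iota _ _](addn1 m) iotaD all_cat /= andbT subnDA add0n IH.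
by case: (p x m); case: all.
Qed.

(** The first hit is the number of j such that no i <= j is a hit; without any hit this is [N x], as
    for [find]. *)
Lemma comp_find (G : Type) (vs : vars G) H N (p : G -> nat -> bool) :
  computable vs H N ->
  compb (ext (ext vs)) (fun x => H x.1.1) (fun x => p x.1.1 x.2) ->
  computable vs H (fun x => find (p x) (iota 0 (N x))).
Proof.
move=> cN cp.
apply: (@eq_comp _ _ _ (fun x => \sum_(0 <= j < N x)
   all (fun i => ~~ p x i) (iota 0 j.+1))) => [x|]; last first.
  apply: (comp_sum cN _); apply: (@compb_all _ _ _ _ (fun y i => ~~ p y.1 i)).
    by apply: comp_S; exact: (comp_var _ _ 0).
  exact: compb_neg.
elim: (N x) => [|m IH]; first by rewrite big_nil.
rewrite big_nat_recr // IH (all_predC (p x)) -[m.+1]addn1 iotaD.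
rewrite add0n has_cat find_cat size_iota.
have [hm|/hasPn hm] := boolP (has (p x) (iota 0 m)); first by rewrite /= addn0.
rewrite hasNfind ?size_iota /=; last exact/hasPn.
by case: (p x m); rewrite ?addn0 ?addn1.
Qed.

Lemma comp_nth (G : Type) (vs : vars G) H tbl f :
  computable vs H f -> computable vs H (fun x => nth 0 tbl (f x)).
Proof.
elim: tbl f => [|a l IH] f cf.
  by apply: eq_comp (comp_cst vs H 0) => x; rewrite nth_nil.
apply: eq_comp (comp_if (compb_eq cf (comp_cst _ _ 0)) (comp_cst _ _ a)
  (IH _ (comp_sub cf (comp_cst _ _ 1)))) => x /=.
by case: (f x) => //= m; rewrite subn1.
Qed.

(** The power may be exponentially large and is never formed: repeated division stays below
    [f x]. *)
Lemma comp_divexp (G : Type) (vs : vars G) H f g h :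
  computable vs H f -> computable vs H g -> computable vs H h ->
  computable vs H (fun x => f x %/ g x ^ h x).
Proof.
move=> cf cg ch; have [_ [F [pF bF _]]] := cf.
have iterE x i : iteri i (fun _ a => a %/ g x) (f x) = f x %/ g x ^ i.
  by elim: i => [|i IH] /=; rewrite ?expn0 ?divn1 // IH -divnMA -expnSr.
apply: eq_comp (fun x => iterE x (h x)) _.
apply: (@comp_iteri _ _ _ _ (fun x _ a => a %/ g x) _ F) => //.
  by move=> x b i wi _; rewrite iterE; apply: leq_trans (leq_div _ _) (bF _ _ wi).
apply: comp_divn; first exact: (comp_var _ _ 0).
exact: (comp_weak (comp_weak cg)).
Qed.

(** * Filling an array *)

Definition fill_vars : vars (nat * nat * memory) := [:: fun g => g.1.1; fun g => g.1.2].

Notation computable_fill := (@computable (nat * nat * memory) fill_vars snd).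

(** The bound [F n] holds for every heap, so sizes do not compound along the array. As [f] may look
    at any heap cell, the heap seen when entry [q] is written appears as some [h] matching the final
    array below [q]. *)
Lemma fill_program (f : nat -> nat -> memory -> nat) (N K O : nat -> nat) F :
  polyn F -> (forall n q h, f n q h <= F n) ->
  computable_fill (fun g => f g.1.1 g.1.2 g.2) ->
  computable_fill (fun g => N g.1.1) ->
  computable_fill (fun g => K g.1.1) ->
  computable_fill (fun g => O g.1.1) ->
  exists P W e, forall n, runs P (input n) ((n + 2) ^ e) (fun M =>
    [/\ M 0 = K n, M 1 = W + O n & forall q, q < N n ->
       exists h : memory, (forall a, a < q -> h a = M (W + a)) /\
         M (W + q) = f n q h]).
Proof.
move=> pF bF [wf [Ff [pFf _ cf]]] [wN [FN [pFN bN cN]]] [wK [FK [pFK _ cK]]]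
  [wO [FO [pFO _ cO]]].
(* Registers 0 and 1 hold n and q, 2 the entries left, 3 the constant 1, 4 an address, 5 and 6
   computed values; the array starts past all scratch space. *)
pose W := 7 + wf + wN + wK + wO.
have rd d : 1 < d -> forall i, i < size fill_vars -> id i < d.
  by move=> d1 i /= i2; apply: leq_trans d1; lia.
have [PN HPN] := cN id 2 W (rd 2 isT) ltac:(rewrite /W; lia).
have [Pf HPf] := cf id 5 W (rd 5 isT) ltac:(rewrite /W; lia).
have [PK HPK] := cK id 5 W (rd 5 isT) ltac:(rewrite /W; lia).
have [PO HPO] := cO id 6 W (rd 6 isT) ltac:(rewrite /W; lia).
pose b n := n + FN n + F n.
have pb : polyn b by pol.
pose body := Then Pf (Then (Const 4 W) (Then (Plus 4 4 1) (Then (WriteAt 4 5)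
  (Then (Plus 1 1 3) (Minus 2 2 3))))).
pose P := Then PN (Then (Const 3 1) (Then (WhileNonzero 2 body) (Then PK (Then PO
  (Then (Const 4 W) (Then (Plus 1 4 6) (Then (Const 4 0) (Plus 0 5 4)))))))).
pose T n := FN n + (1 + (FN n * (Ff (b n) + 6) + 1 + (FK (b n) + (FO (b n) + 4)))).
have [e He] : polyn T.
  by pol; [apply: polyn_comp pFf pb|apply: polyn_comp pFK pb|apply: polyn_comp pFO pb].
exists P, W, e => n.
have within_fill q h : q <= b n -> (forall a, h a <= b n) ->
    within fill_vars snd (b n) (n, q, h).
  by move=> qb hb; split=> // -[|[|i]] //=; rewrite ?nth_nil // /b; lia.
have wi0 : within fill_vars snd n (n, 0, fun=> 0).
  by split=> // -[|[|i]] //=; rewrite nth_nil.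
have NF : N n <= FN n := bN _ _ wi0.
have loaded_fill q h M : M 0 = n -> M 1 = q -> (forall a, M (W + a) = h a) ->
    loaded fill_vars snd id W (n, q, h) M.
  by move=> M0 M1 MW; split=> // -[|[|i]].
apply: (@runs_weak _ _ (FN n + (1 + (N n * (Ff (b n) + 5).+1 + 1 +
   (FK (b n) + (FO (b n) + (1 + (1 + (1 + 1)))))))) _ _); first last.
- move=> M' x; exact: x.
- apply: leq_trans (He n); rewrite /T.
  have : N n * (Ff (b n) + 5).+1 <= FN n * (Ff (b n) + 6) by apply: leq_mul => //; lia.
  by lia.
have lo0 : loaded fill_vars snd id W (n, 0, fun=> 0) (input n).
  by apply: loaded_fill => // a; rewrite /input /W; upd.
apply: runs_then (HPN _ _ _ wi0 lo0) _ => M1 [M1d M1j].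
apply: (runs_then (Post1 := fun M' => M' = update M1 3 1)); first exact: runs_const.
move=> _ ->.
pose filled k (M : memory) := forall q, q < k -> exists h : memory,
  (forall a, a < q -> h a = M (W + a)) /\ M (W + q) = f n q h.
pose Inv m (M : memory) := [/\ m <= N n, M 0 = n, M 1 = N n - m, M 2 = m &
   [/\ M 3 = 1, forall a, M (W + a) <= F n & filled (N n - m) M]].
pose Post (M : memory) := [/\ M 0 = n, M 1 = N n, forall a, M (W + a) <= F n &
  filled (N n) M].
apply: (runs_then (Post1 := Post)); last first.
  move=> M2 [M20 M21 M2F fil].
  have wi2 : within fill_vars snd (b n) (n, N n, fun a => M2 (W + a)).
    by apply: within_fill => [|a]; [| have := M2F a]; rewrite /b; lia.
  have lo2 : loaded fill_vars snd id W (n, N n, fun a => M2 (W + a)) M2.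
    exact: loaded_fill.
  apply: runs_then (HPK _ _ _ wi2 lo2) _ => M3 [M3d M3j] /=.
  have lo3 : loaded fill_vars snd id W (n, N n, fun a => M2 (W + a)) M3.
    exact: loaded_frame (rd 5 isT) M3j lo2.
  apply: runs_then (HPO _ _ _ wi2 lo3) _ => M4 [M4d M4j] /=.
  apply: (runs_then (Post1 := fun M' => M' = update M4 4 W)); first exact: runs_const.
  move=> _ ->.
  pose M5 := update (update M4 4 W) 1 (W + M4 6).
  apply: (runs_then (Post1 := fun M' => M' = M5)); first exact: runs_plus.
  move=> _ ->.
  apply: (runs_then (Post1 := fun M' => M' = update M5 4 0)); first exact: runs_const.
  move=> _ ->; apply: runs_plus; rewrite /M5.
  have eqW a : update (update (update (update M4 4 W) 1 (W + M4 6)) 4 0) 0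
    (update (update (update M4 4 W) 1 (W + M4 6)) 4 0 5 +
     update (update (update M4 4 W) 1 (W + M4 6)) 4 0 4) (W + a) = M2 (W + a).
    by rewrite /W; upd; rewrite -/W M4j ?M3j //; right; rewrite /W; lia.
  split=> [||q qN].
  - by rewrite /update /= addn0 M4j ?M3d //; left.
  - by rewrite /update /= M4d.
  have [h [h1 h2]] := fil q qN.
  by exists h; split=> [a aq|]; rewrite eqW // h1.
apply: (@runs_while _ _ _ _ Inv); last first.
- split=> //; first by rewrite /update /= M1j //; left.
  + by rewrite /update /= subnn M1j //; left.
  + split=> // [a|q]; last by rewrite subnn.
    by rewrite /W; upd; rewrite M1j /input; upd.
- move=> M [_ M0 M1' -> [_ MF fil]]; split=> //; split=> //; first by rewrite M1' subn0.
  by move: fil; rewrite subn0.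
move=> m M mN [_ M0 M1' M2 [M3 MF fil]]; split; first by rewrite M2.
set q := N n - m.+1 in M1' fil.
have wi : within fill_vars snd (b n) (n, q, fun a => M (W + a)).
  by apply: within_fill => [|a]; [| have := MF a]; rewrite /b /q; lia.
have lo : loaded fill_vars snd id W (n, q, fun a => M (W + a)) M by exact: loaded_fill.
apply: (@runs_weak _ _ (Ff (b n) + (1 + (1 + (1 + (1 + 1))))) _ _); first last.
- move=> M' x; exact: x.
- by lia.
apply: runs_then (HPf _ _ _ wi lo) _ => M4 [M4d M4j] /=.
apply: (runs_then (Post1 := fun M' => M' = update M4 4 W)); first exact: runs_const.
move=> _ ->.
pose M5 := update (update M4 4 W) 4 (W + q).
apply: (runs_then (Post1 := fun M' => M' = M5)).
  by apply: runs_plus; rewrite /M5 /update /= M4j ?M1' //; left.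
move=> _ ->.
pose v := f n q (fun a => M (W + a)).
pose M6 := update M5 (W + q) v.
apply: (runs_then (Post1 := fun M' => M' = M6)).
  by apply: runs_write; rewrite /M6 /M5 /update /= M4d.
move=> _ ->.
pose M7 := update M6 1 q.+1.
apply: (runs_then (Post1 := fun M' => M' = M7)).
  apply: runs_plus; rewrite /M7; congr (update _ _ _).
  rewrite /M6 /M5 /W /update /= M4j ?M1' ?M4j ?M3 ?addn1 //; by left.
move=> _ ->; apply: runs_minus.
have eqW a : update M7 2 (M7 2 - M7 3) (W + a) = if a == q then v else M (W + a).
  have [e1 e2 e4] : [/\ (W + a == 1) = false, (W + a == 2) = false & (W + a == 4) = false].
    by rewrite /W; split; lia.
  rewrite /M7 /M6 /M5 /update e1 e2 e4 eqn_add2l; case: ifP => // _.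
  by rewrite M4j //; right; rewrite leq_addr.
split; first by lia.
- by rewrite /M7 /M6 /M5 /W /update /= M4j ?M0 //; left.
- by rewrite /M7 /update /= /q; lia.
- rewrite /M7 /M6 /M5 /W /update /= !M4j ?M2 ?M3 ?subn1 //; by left.
split.
- by rewrite /M7 /M6 /M5 /W /update /= M4j ?M3 //; left.
- by move=> a; rewrite eqW; case: eqP => // _; apply: bF.
move=> q' q'q.
have qE : N n - m = q.+1 by rewrite /q; lia.
move: q'q; rewrite qE ltnS leq_eqVlt => /orP[/eqP ->|q'q].
  exists (fun a => M (W + a)); split=> [a aq|]; rewrite eqW ?eqxx //.
  by rewrite ltn_eqF.
have [h [h1 h2]] := fil q' q'q; exists h; split=> [a aq|]; rewrite eqW.
  by rewrite ltn_eqF ?h1 //; apply: ltn_trans q'q.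
by rewrite ltn_eqF.
Qed.

(** * The greedy algorithm *)

(** For r > 0 the test holds exactly below the least T with n < 2^(T^r), so the count is T, just
    above the r-th root of log_2 n. *)
Definition root_log r n := \sum_(0 <= t < n) (2 ^ (t ^ r) <= n).

Lemma root_logP r n : 0 < r ->
  n < 2 ^ (root_log r n ^ r) /\ forall t, t < root_log r n -> 2 ^ (t ^ r) <= n.
Proof.
move=> r0; have ex : exists t, n < 2 ^ (t ^ r).
  exists n; apply: leq_trans (ltn_expl n (isT : 1 < 2)) _.
  by rewrite leq_exp2l //; case: n => // n; rewrite -{1}(expn1 n.+1) leq_pexp2l.
case: (ex_minnP ex) => T nT minT.
have Tn : T <= n.
  apply: minT; apply: leq_trans (ltn_expl n (isT : 1 < 2)) _.
  by rewrite leq_exp2l //; case: (n) => // n'; rewrite -{1}(expn1 n'.+1) leq_pexp2l.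
have ltT t : (2 ^ (t ^ r) <= n) = (t < T).
  case: (ltnP t T) => tT.
    by rewrite leqNgt; apply/negP => /minT; rewrite leqNgt tT.
  apply/negbTE; rewrite -ltnNge; apply: leq_trans nT _.
  by rewrite leq_exp2l // expn_mono.
have -> : root_log r n = T.
  by rewrite -[RHS](sum_ltn_nat Tn); apply: eq_bigr => t _; rewrite ltT.
by split=> // t; rewrite ltT.
Qed.

Lemma root_log_le r n : root_log r n <= n.
Proof.
rewrite /root_log; apply: (@leq_trans (\sum_(0 <= t < n) 1)).
  by apply: leq_sum => t _; apply: leq_b1.
by rewrite sum_nat_const_nat subn0 muln1.
Qed.

(** Minimality gives 2^((T-1)^r) <= n, and T <= 2(T-1) once T >= 2: rounding up to an r-th power
    costs a factor 2^r in the exponent. *)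
Lemma expn_root_log r n : 0 < r -> 2 ^ (root_log r n ^ r) <= (n + 2) ^ (2 ^ r).
Proof.
move=> r0; have [_ ltT] := root_logP n r0.
case: (root_log r n) ltT => [|[|t]] ltT.
- by rewrite exp0n // expn_gt0 addn2.
- rewrite exp1n; apply: (@leq_trans (n + 2)); first by rewrite leq_addl.
  by rewrite -{1}(expn1 (n + 2)) leq_pexp2l ?addn2 // expn_gt0.
apply: (@leq_trans ((2 ^ (t.+1 ^ r)) ^ (2 ^ r))).
  rewrite -expnM leq_exp2l // -expnMn expn_mono //; lia.
by apply: expn_mono; apply: leq_trans (ltT _ (ltnSn _)) _; rewrite leq_addr.
Qed.

Definition columns r A n := A * root_log r n ^ r.

Lemma word_count_le r A Q n : 0 < r ->
  Q ^ columns r A n <= (n + 2) ^ (2 ^ r * (Q * A)).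
Proof.
move=> r0; apply: (@leq_trans ((2 ^ Q) ^ columns r A n)).
  by apply: expn_mono; apply: ltnW; apply: ltn_expl.
rewrite /columns -expnM mulnA mulnC expnM [in leqRHS]expnM.
exact/expn_mono/expn_root_log.
Qed.

Lemma comp_root_log (G : Type) (vs : vars G) H r n :
  computable vs H n -> computable vs H (fun x => root_log r (n x)).
Proof.
move=> cn; apply: (comp_sum cn).
(* The power itself is too large to compute, but whether it divides into n at least once is decided
   by [comp_divexp]. *)
apply: (@eq_comp _ _ _ (fun p => nat_of_bool (1 <= n p.1 %/ 2 ^ (p.2 ^ r)))) => [p|].
  by rewrite divn_gt0 ?expn_gt0.
apply: compb_leq; first exact: comp_cst.
apply: comp_divexp; [exact: (comp_weak cn) | exact: comp_cst |].
by apply: comp_expc; exact: (comp_var _ _ 0).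
Qed.

Lemma comp_columns (G : Type) (vs : vars G) H r A n :
  computable vs H n -> computable vs H (fun x => columns r A (n x)).
Proof.
by move=> cn; apply: comp_mul (comp_expc _ (comp_root_log _ cn)); apply: comp_cst.
Qed.

Lemma comp_word_count (G : Type) (vs : vars G) H r A Q n :
  0 < r -> 0 < Q -> computable vs H n ->
  computable vs H (fun x => Q ^ columns r A (n x)).
Proof.
move=> r0 Q0 cn; have [_ [F [pF bF _]]] := cn.
have iterE i : iteri i (fun _ a => a * Q) 1 = Q ^ i.
  by elim: i => [|i IH] //=; rewrite IH expnSr.
apply: eq_comp (fun x => iterE _) _.
apply: (@comp_iteri _ _ _ _ (fun _ _ a => a * Q) _
   (fun b => (F b + 2) ^ (2 ^ r * (Q * A)))).
- by pol.
- move=> x b i wi iN; rewrite iterE.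
  apply: (@leq_trans (Q ^ columns r A (n x))); first by rewrite leq_pexp2l.
  apply: leq_trans (word_count_le _ _ _ r0) _.
  by apply: expn_mono; rewrite leq_add2r bF.
- exact: comp_columns.
- exact: comp_cst.
by apply: comp_mul; [exact: (comp_var _ _ 0) | apply: comp_cst].
Qed.

Definition digit B v i := v %/ B ^ i %% B.

Lemma comp_digit (G : Type) (vs : vars G) H B v i :
  computable vs H B -> computable vs H v -> computable vs H i ->
  computable vs H (fun x => digit (B x) (v x) (i x)).
Proof. by move=> cB cv ci; exact: comp_modn (comp_divexp cv cB ci) cB. Qed.

(* [U] codes [r.-1] constraints, that the word at address [y] has letter [x]
   in column [i], by its digits [y * Q + x]; addresses [y >= m] hold no word yet
   and impose nothing. *)
Definition obeys Q n m (h : memory) U i j :=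
  (m <= digit (n * Q) U j %/ Q) ||
  (digit Q (h (digit (n * Q) U j %/ Q)) i == digit (n * Q) U j %% Q).

Definition selected r Q n m h U i := all (obeys Q n m h U i) (iota 0 r.-1).

(** This is |Q c - w| <= k / D with denominators cleared. The tolerance is relative to all k
    columns, as the number w of selected ones may be tiny. *)
Definition balanced r Q D k n m h v U a :=
  let w := \sum_(0 <= i < k) selected r Q n m h U i in
  let c := \sum_(0 <= i < k) (selected r Q n m h U i && (digit Q v i == a)) in
  (D * (Q * c) <= D * w + k) && (D * w <= D * (Q * c) + k).

Definition good_word r Q D k n m h v :=
  all (fun U => all (balanced r Q D k n m h v U) (iota 0 Q))
    (iota 0 ((n * Q) ^ r.-1)).

Definition next_word r Q D A n m h :=
  find (good_word r Q D (columns r A n) n m h) (iota 0 (Q ^ columns r A n)).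

Lemma compb_selected (G : Type) (vs : vars G) H r Q n m U i :
  computable vs H n -> computable vs H m -> computable vs H U -> computable vs H i ->
  compb vs H (fun x => selected r Q (n x) (m x) (H x) (U x) (i x)).
Proof.
move=> cn cm cU ci; apply: (@compb_all _ _ _ _ (fun x => obeys Q (n x) (m x) (H x) (U x) (i x))).
  exact: comp_cst.
have cQ : computable (ext vs) (fun x => H x.1) (fun=> Q) by apply: comp_cst.
have cp : computable (ext vs) (fun x => H x.1) (fun x => digit (n x.1 * Q) (U x.1) x.2).
  apply: comp_digit; [exact: comp_mul (comp_weak cn) cQ | exact: (comp_weak cU) |].
  exact: (comp_var _ _ 0).
apply: compb_or; first exact: compb_leq (comp_weak cm) (comp_divn cp cQ).
apply: compb_eq (comp_modn cp cQ); apply: comp_digit (comp_weak ci) => //.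
exact: comp_get (comp_divn cp cQ).
Qed.

Lemma compb_balanced (G : Type) (vs : vars G) H r Q D k n m v U a :
  computable vs H k -> computable vs H n -> computable vs H m ->
  computable vs H v -> computable vs H U -> computable vs H a ->
  compb vs H (fun x => balanced r Q D (k x) (n x) (m x) (H x) (v x) (U x) (a x)).
Proof.
move=> ck cn cm cv cU ca; rewrite /balanced.
have ci : computable (ext vs) (fun x => H x.1) snd by exact: (comp_var _ _ 0).
have cs := @compb_selected _ _ _ r Q _ _ _ _ (comp_weak cn) (comp_weak cm) (comp_weak cU) ci.
have cw := comp_mul (comp_cst vs H D) (@comp_sum _ _ _ _
  (fun x i => nat_of_bool (selected r Q (n x) (m x) (H x) (U x) i)) ck cs).
have cd := compb_eq (comp_digit (comp_cst _ _ Q) (comp_weak cv) ci) (comp_weak ca).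
have cc := comp_mul (comp_cst vs H D) (comp_mul (comp_cst vs H Q) (@comp_sum _ _ _ _
  (fun x i => nat_of_bool (selected r Q (n x) (m x) (H x) (U x) i &&
     (digit Q (v x) i == a x))) ck (compb_and cs cd))).
by apply: compb_and; apply: compb_leq => //; apply: comp_add.
Qed.

Lemma comp_next_word (G : Type) (vs : vars G) H r Q D A n m : 0 < r -> 0 < Q ->
  computable vs H n -> computable vs H m ->
  computable vs H (fun x => next_word r Q D A (n x) (m x) (H x)).
Proof.
move=> r0 Q0 cn cm; apply: (@comp_find _ _ _ _
  (fun x => good_word r Q D (columns r A (n x)) (n x) (m x) (H x))).
  exact: comp_word_count.
have cn2 := comp_weak (comp_weak cn); have cm2 := comp_weak (comp_weak cm).
apply: (@compb_all _ _ _ _ (fun x U => all (balanced r Q D (columns r A (n x.1.1))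
  (n x.1.1) (m x.1.1) (H x.1.1) x.2 U) (iota 0 Q))).
  exact: comp_expc (comp_mul cn2 (comp_cst _ _ Q)).
apply: (@compb_all _ _ _ _ (fun x a => balanced r Q D (columns r A (n x.1.1.1))
  (n x.1.1.1) (m x.1.1.1) (H x.1.1.1) x.1.2 x.2 a)); first exact: comp_cst.
(* Four variables were added: the prefix bound and the candidate of [comp_find], the constraint
   code, the letter. *)
have cn4 := comp_weak (comp_weak cn2); have cm4 := comp_weak (comp_weak cm2).
apply: (@compb_balanced _ _ _ _ _ _ (fun x => columns r A (n x.1.1.1.1))
  (fun x => n x.1.1.1.1) (fun x => m x.1.1.1.1) (fun x => x.1.1.2) (fun x => x.1.2)
  (fun x => x.2)) => //; first exact: comp_columns.
- exact: (comp_var _ _ 2).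
- exact: (comp_var _ _ 1).
- exact: (comp_var _ _ 0).
Qed.

Lemma digit_surj Q k (phi : nat -> nat) : (forall i, phi i < Q) ->
  exists v, v < Q ^ k /\ forall i, i < k -> digit Q v i = phi i.
Proof.
move=> phiQ; have Q0 : 0 < Q by apply: leq_trans (phiQ 0).
elim: k phi phiQ => [|k IH] phi phiQ; first by exists 0.
have [v [vlt vphi]] := IH (fun i => phi i.+1) (fun i => phiQ i.+1).
exists (v * Q + phi 0); split=> [|[|i] ik].
- have := phiQ 0; rewrite expnSr; nia.
- by rewrite /digit expn0 divn1 modnMDl modn_small.
by rewrite /digit expnS divnMA divnMDl // (divn_small (phiQ 0)) addn0; apply: vphi.
Qed.

(** The left side counts the bad events of the later union bound: two signs, Q letters, (nQ)^(r-1)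
    codes. As n < 2^(T^r), it is at most a power with exponent T^r and base free of n. *)
Lemma constraint_count r Q n : 0 < r -> 0 < Q -> 0 < n ->
  2 * Q * (n * Q) ^ r.-1 <= (2 * Q ^ r.+1 * 2 ^ r) ^ (root_log r n ^ r).
Proof.
move=> r0 Q0 n0; have [nL _] := root_logP n r0.
have L0 : 0 < root_log r n ^ r by move: nL; case: (_ ^ r) => //; lia.
set L := _ ^ r in nL L0 *.
apply: (@leq_trans ((2 * Q ^ r) * n ^ r.-1)).
  rewrite -{2}(prednK r0) expnS expnMn; set x := Q ^ _; set y := n ^ _.
  by rewrite leq_eqVlt; apply/orP; left; apply/eqP; ring.
rewrite expnMn; apply: leq_mul.
  apply: (@leq_trans (2 * Q ^ r.+1)); first by rewrite leq_mul2l leq_pexp2l.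
  by rewrite -{1}(expn1 (2 * Q ^ r.+1)) leq_pexp2l // muln_gt0 expn_gt0 Q0.
apply: leq_trans (expn_mono _ (ltnW nL)) _.
by rewrite -!expnM leq_exp2l // mulnC leq_mul2r leq_pred orbT.
Qed.

(* The three cells of entry [e = ((i * s) + j) * n + m], in the order expected by
   [output_entry]: the value is read in row [j] of the table [tbl], at the letter
   of coordinate [m] in column [i]. *)
Definition output_cell r Q s Z tbl n (h : memory) q :=
  let e := q %/ 3 in
  let m := e %% n in let f := e %/ n in
  if q %% 3 == 0 then nth 0 tbl (f %% s * Q + digit Q (h m) (f %/ s))
  else if q %% 3 == 1 then 0 else (root_log r n * Z).-1.

(** Words and output share one array, so that output cells can read the words already stored in the
    first n cells. *)
Definition fill_cell r Q D A s Z tbl n q (h : memory) :=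
  if q < n then next_word r Q D A n q h
  else output_cell r Q s Z tbl n h (q - n).

Lemma comp_output_cell (G : Type) (vs : vars G) H r Q s Z tbl n q :
  computable vs H n -> computable vs H q ->
  computable vs H (fun x => output_cell r Q s Z tbl (n x) (H x) (q x)).
Proof.
move=> cn cq; have cc c : computable vs H (fun=> c) by apply: comp_cst.
have ce := comp_divn cq (cc 3); have cw := comp_modn cq (cc 3).
have cm := comp_modn ce cn; have cf := comp_divn ce cn.
apply: comp_if; first exact: compb_eq.
  apply: comp_nth; apply: comp_add; first exact: comp_mul (comp_modn cf (cc s)) (cc Q).
  exact: comp_digit (cc Q) (comp_get cm) (comp_divn cf (cc s)).
apply: comp_if (compb_eq cw (cc 1)) (cc 0) _.
apply: eq_comp (comp_sub (comp_mul (comp_root_log r cn) (cc Z)) (cc 1)) => x.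
by rewrite subn1.
Qed.

Lemma leq_nth_sum (tbl : seq nat) i : nth 0 tbl i <= \sum_(x <- tbl) x.
Proof.
elim: tbl i => [|a l IH] i; first by rewrite nth_nil.
rewrite big_cons; case: i => [|i] /=; first exact: leq_addr.
exact: leq_trans (IH i) (leq_addl _ _).
Qed.

Lemma algorithm_spec r Q D A s Z tbl : 0 < r -> 0 < Q ->
  exists P W e, forall n, 0 < n -> runs P (input n) ((n + 2) ^ e) (fun M =>
    [/\ M 0 = columns r A n, M 1 = W + n,
      forall m, m < n -> exists h : memory, (forall a, a < m -> h a = M (W + a)) /\
        M (W + m) = next_word r Q D A n m h &
      forall i j m, i < columns r A n -> j < s -> m < n ->
        let p := M 1 + 3 * ((i * s + j) * n + m) in
        [/\ M p = nth 0 tbl (j * Q + digit Q (M (W + m)) i), M p.+1 = 0 &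
            M p.+2 = (root_log r n * Z).-1]]).
Proof.
move=> r0 Q0.
pose F n := (n + 2) ^ (2 ^ r * (Q * A)) + (\sum_(x <- tbl) x + n * Z).
pose f := fill_cell r Q D A s Z tbl.
pose N n := n + 3 * (columns r A n * s * n).
have cn : computable_fill (fun g => g.1.1) by exact: (comp_var fill_vars snd 0).
have cq : computable_fill (fun g => g.1.2) by exact: (comp_var fill_vars snd 1).
have pF : polyn F by pol.
have bF n q h : f n q h <= F n.
  rewrite /f /fill_cell; case: ifP => _.
    apply: leq_trans (leq_trans (word_count_le A Q n r0) (leq_addr _ _)).
    by rewrite -[leqRHS](size_iota 0) find_size.
  apply: leq_trans (leq_addl _ _); rewrite /output_cell; case: ifP => _.
    exact: leq_trans (leq_nth_sum _ _) (leq_addr _ _).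
  case: ifP => // _; apply: leq_trans (leq_addl _ _).
  by apply: leq_trans (leq_pred _) _; rewrite leq_mul2r root_log_le orbT.
have cf : computable_fill (fun g => f g.1.1 g.1.2 g.2).
  apply: comp_if (compb_leq (comp_S cq) cn) (comp_next_word _ _ r0 Q0 cn cq) _.
  exact: comp_output_cell cn (comp_sub cq cn).
have ck := comp_columns r A cn.
have cN : computable_fill (fun g => N g.1.1).
  exact: comp_add cn (comp_mul (comp_cst _ _ 3)
    (comp_mul (comp_mul ck (comp_cst _ _ s)) cn)).
have [P [W [e HP]]] := @fill_program _ _ _ id _ pF bF cf cN ck cn.
exists P, W, e => n n0; apply: runs_weak (HP n) (leqnn _) _ => M [M0 M1 fil].
have fil_word m : m < n -> exists h : memory, (forall a, a < m -> h a = M (W + a)) /\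
    M (W + m) = next_word r Q D A n m h.
  move=> mn; have [h [h1 h2]] := fil m (leq_trans mn (leq_addr _ _)).
  by exists h; split=> //; rewrite h2 /f /fill_cell mn.
split=> // i j m ik js mn p.
set E := (i * s + j) * n + m in p *.
have Elt : E < columns r A n * s * n.
  have : (i * s + j).+1 <= columns r A n * s.
    by apply: (@leq_trans (i.+1 * s)); rewrite ?leq_mul2r ?ik ?orbT // mulSn; lia.
  by move=> /(leq_mul (leqnn n)); rewrite mulnS /E; lia.
have cell w : w < 3 -> exists h : memory, (forall a, a < n -> h a = M (W + a)) /\
    M (p + w) = output_cell r Q s Z tbl n h (3 * E + w).
  move=> w3; have [|h [h1 h2]] := fil (n + (3 * E + w)); first by rewrite /N; lia.
  exists h; split=> [a an|]; first by rewrite h1 //; lia.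
  have -> : p + w = W + (n + (3 * E + w)) by rewrite /p M1; lia.
  by rewrite h2 /f /fill_cell ltnNge leq_addr /= addKn.
have E3 w : w < 3 -> (3 * E + w) %/ 3 = E /\ (3 * E + w) %% 3 = w.
  by move=> w3; split; lia.
have Em : E %% n = m by rewrite /E modnMDl modn_small.
have En : E %/ n = i * s + j by rewrite /E divnMDl // divn_small // addn0.
have s0 : 0 < s by apply: leq_trans js.
split.
- have [h [h1]] := cell 0 isT; rewrite addn0 /output_cell.
  have [-> ->] := E3 0 isT; rewrite eqxx Em En h1 // => ->.
  by rewrite modnMDl modn_small // divnMDl // divn_small // addn0.
- have [h [h1]] := cell 1 isT; rewrite addn1 /output_cell.
  by have [_ ->] := E3 1 isT.
have [h [h1]] := cell 2 isT; rewrite addn2 /output_cell.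
by have [_ ->] := E3 2 isT.
Qed.

Local Open Scope ring_scope.

Local Notation expR := sequences.expR.

(** * Existence of good words *)

(** By e^s >= 1 + s at s = 2t^2 - t, it suffices that (1 + t)(1 - t + 2t^2) = 1 + t^2 (1 + 2t) is at
    least 1, which is where -1/2 comes from. *)
Lemma expR_le_1Dx (R : realType) (t : R) : - (1 / 2) <= t ->
  expR (t - 2 * t ^+ 2) <= 1 + t.
Proof.
move=> t2; have lo : 1 + (2 * t ^+ 2 - t) <= expR (- (t - 2 * t ^+ 2)).
  by rewrite opprB; apply: expR_ge1Dx.
have pos : 0 < 1 + (2 * t ^+ 2 - t) by nra.
have ge1 : 1 <= (1 + t) * (1 + (2 * t ^+ 2 - t)) by nra.
have t1 : 0 <= 1 + t by lra.
have ge1' : 1 <= (1 + t) * expR (- (t - 2 * t ^+ 2)).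
  by apply: le_trans ge1 _; apply: ler_wpM2l.
rewrite -[leLHS]mulr1; apply: le_trans (ler_wpM2l (expR_ge0 _) ge1') _.
by rewrite mulrCA -expRD subrr expR0 mulr1.
Qed.

(** The sum is Q c - w in the notation of [balanced]; the signs 1 and -1 give the failures of its
    two inequalities. *)
Definition deviates (R : realType) k Q D (W : 'I_k -> bool) (a : 'I_Q) (sg : R)
    (v : {ffun 'I_k -> 'I_Q}) : bool :=
  k%:R < D%:R * (sg * (\sum_(i < k) (W i)%:R * (Q%:R * (v i == a)%:R - 1))).

(* Exponential moment method, with [1 + t] in place of the exponential so that
   the moment is exactly [Q ^ k]. *)
Lemma chernoff (R : realType) k Q D (W : 'I_k -> bool) (a : 'I_Q) (sg : R) :
  (0 < Q)%N -> (0 < D)%N -> sg ^+ 2 = 1 ->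
  (\sum_(v : {ffun 'I_k -> 'I_Q}) (deviates D W a sg v)%:R) *
   expR (k%:R / (8 * D%:R ^+ 2 * Q%:R ^+ 2)) <= Q%:R ^+ k :> R.
Proof.
move=> Q0 D0 sg2.
have Q1 : 1 <= Q%:R :> R by rewrite ler1n.
have D1 : 1 <= D%:R :> R by rewrite ler1n.
set q : R := Q%:R in Q1 *; set d : R := D%:R in D1 *.
(* With this size |t| <= 1/4, and on a deviating word the sum of t exceeds k / (4 d^2 q^2), while
   twice the sum of t^2 is at most half of that. *)
pose lam := sg / (4 * d * q ^+ 2).
pose t (i : 'I_k) (x : 'I_Q) := lam * ((W i)%:R * (q * (x == a)%:R - 1)).
have lamE : lam ^+ 2 * q ^+ 2 = 1 / (16 * d ^+ 2 * q ^+ 2).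
  rewrite /lam expr_div_n sg2; field.
  by rewrite !lt0r_neq0 //; lra.
have t_sq i x : t i x ^+ 2 <= 1 / (16 * d ^+ 2 * q ^+ 2).
  rewrite -lamE /t exprMn; apply: ler_wpM2l; first exact: sqr_ge0.
  by case: (W i); case: (x == a); rewrite /= ?mul1r ?mul0r ?mulr1 ?mulr0; nra.
have dq1 : 1 <= d ^+ 2 * q ^+ 2.
  by rewrite -[leLHS]mulr1; apply: ler_pM; rewrite ?ler01 ?exprn_ege1.
have t_ge i x : - (1 / 2) <= t i x.
  have : t i x ^+ 2 <= 1 / 16.
    apply: le_trans (t_sq i x) _; rewrite !div1r lef_pV2 ?posrE; nra.
  nra.
(* In each column the values [t i x] sum to 0 over the Q letters. *)
have moment : \sum_(v : {ffun 'I_k -> 'I_Q}) \prod_(i < k) (1 + t i (v i)) = q ^+ k.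
  rewrite -(bigA_distr_bigA (fun i x => 1 + t i x)) /=.
  rewrite (eq_bigr (fun=> q)) ?prodr_const ?card_ord // => i _.
  rewrite big_split /= sumr_const card_ord -mulr_sumr -mulr_sumr sumrB.
  rewrite sumr_const card_ord -mulr_sumr.
  rewrite (bigD1 a) //= eqxx big1 ?addr0 ?mulr1 ?subrr ?mulr0 ?addr0 //.
  by move=> x /negbTE ->.
rewrite -moment mulr_suml; apply: ler_sum => v _.
have prod0 : 0 <= \prod_(i < k) (1 + t i (v i)).
  by apply: prodr_ge0 => i _; have := t_ge i (v i); lra.
rewrite /deviates; case: ltP => bad /=; last by rewrite mul0r.
rewrite mul1r; set S := \sum_(i < k) _ in bad.
apply: le_trans (_ : expR (\sum_(i < k) (t i (v i) - 2 * t i (v i) ^+ 2)) <= _); last first.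
  rewrite (big_morph _ (@expRD R) (@expR0 R)); apply: ler_prod => i _.
  by rewrite expR_ge0 expR_le_1Dx.
rewrite ler_expR sumrB -mulr_sumr -/S -[X in _ - X]mulr_sumr.
have sq : \sum_(i < k) t i (v i) ^+ 2 <= k%:R * (1 / (16 * d ^+ 2 * q ^+ 2)).
  apply: le_trans (ler_sum _ (fun i _ => t_sq i (v i))) _.
  by rewrite sumr_const card_ord [leRHS]mulr_natl.
have : k%:R / (4 * d ^+ 2 * q ^+ 2) <= lam * S.
  rewrite (_ : lam * S = d * (sg * S) / (4 * d ^+ 2 * q ^+ 2)); last first.
    by rewrite /lam; field; rewrite !lt0r_neq0 //; lra.
  by apply: ler_wpM2r (ltW bad); rewrite invr_ge0; nra.
have -> : k%:R / (4 * d ^+ 2 * q ^+ 2) = 4 * (k%:R * (1 / (16 * d ^+ 2 * q ^+ 2))).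
  by field; rewrite !lt0r_neq0 //; lra.
have -> : k%:R / (8 * d ^+ 2 * q ^+ 2) = 2 * (k%:R * (1 / (16 * d ^+ 2 * q ^+ 2))).
  by field; rewrite !lt0r_neq0 //; lra.
by lra.
Qed.

Lemma deviation_bounds (R : realType) (D Q c w k : nat) :
  D%:R * (1 * (Q%:R * c%:R - w%:R)) <= k%:R :> R ->
  D%:R * (- 1 * (Q%:R * c%:R - w%:R)) <= k%:R :> R ->
  ((D * (Q * c) <= D * w + k) && (D * w <= D * (Q * c) + k))%N.
Proof.
move=> dev1 dev2; apply/andP; split; rewrite -(ler_nat R) natrD !natrM; lra.
Qed.

(** The earlier words [h] are arbitrary, so no choice can block the greedy search. The condition on
    [A] makes the exponent in [chernoff] at least C T^r, where C is the base in [constraint_count];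
    then e^C > C lets the union bound succeed. *)
Lemma exists_good_word (R : realType) r Q D A n m h :
  (0 < r)%N -> (0 < Q)%N -> (0 < D)%N -> (0 < n)%N ->
  (8 * D ^ 2 * Q ^ 2 * (2 * Q ^ r.+1 * 2 ^ r) <= A)%N ->
  exists v, (v < Q ^ columns r A n)%N /\ good_word r Q D (columns r A n) n m h v.
Proof.
move=> r0 Q0 D0 n0 Abig.
set k := columns r A n; set B := ((n * Q) ^ r.-1)%N.
pose W U (i : 'I_k) := selected r Q n m h U i.
pose E : R := expR (k%:R / (8 * D%:R ^+ 2 * Q%:R ^+ 2)).
have E_big : (2 * Q * B)%:R < E.
  set C := (2 * Q ^ r.+1 * 2 ^ r)%N in Abig.
  have [nL _] := root_logP n r0.
  have L0 : (0 < root_log r n ^ r)%N by move: nL; case: (_ ^ r)%N => //; lia.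
  have pos : 0 < 8 * D%:R ^+ 2 * Q%:R ^+ 2 :> R.
    by rewrite !mulr_gt0 ?exprn_gt0 ?ltr0n.
  have CA : C%:R <= A%:R / (8 * D%:R ^+ 2 * Q%:R ^+ 2) :> R.
    rewrite ler_pdivlMr // mulrC -!natrX -!natrM ler_nat; exact: Abig.
  apply: (@le_lt_trans _ _ (C%:R ^+ (root_log r n ^ r))).
    by rewrite -natrX ler_nat; apply: constraint_count.
  rewrite /E /k /columns natrM mulrAC expRM_natr.
  rewrite ltr_pXn2r ?nnegrE ?ler0n ?expR_ge0 //.
  apply: lt_le_trans (_ : 1 + C%:R <= _); first by rewrite ltrDr ltr01.
  apply: le_trans (expR_ge1Dx _) _; rewrite ler_expR; exact: CA.
have double_count (x : R) (a b : nat) : 2%:R * x *+ a *+ b <= x * (2 * a * b)%:R.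
  by rewrite -mulrnA -[leLHS]mulr_natr -mulnA (natrM _ 2) mulrA (mulrC x).
have ge1 (x y : bool) : ~~ (~~ x && ~~ y) -> 1 <= x%:R + y%:R :> R.
  by case: x; case: y => // _; rewrite -natrD ler1n.
have [phi phiP] : exists phi : {ffun 'I_k -> 'I_Q}, forall (U : 'I_B) (a : 'I_Q),
    ~~ deviates D (W U) a (1 : R) phi /\ ~~ deviates D (W U) a (-1 : R) phi.
  pose p phi := [forall U : 'I_B, forall a : 'I_Q,
    ~~ deviates D (W U) a (1 : R) phi && ~~ deviates D (W U) a (-1 : R) phi].
  case: (pickP p) => [phi /forallP ok|none].
    by exists phi => U a; have /forallP/(_ a)/andP := ok U.
  (* [S] counts pairs of a word and a bad event. If every word had one, Q^k <= S, against S E <= Q^k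
     (2QB) < Q^k E. *)
  pose S := \sum_(phi : {ffun 'I_k -> 'I_Q}) \sum_(U : 'I_B) \sum_(a : 'I_Q)
    ((deviates D (W U) a (1 : R) phi)%:R + (deviates D (W U) a (-1 : R) phi)%:R : R).
  have loS : Q%:R ^+ k <= S.
    rewrite -natrX -[in leLHS](card_ord Q) -[in leLHS](card_ord k) -card_ffun.
    rewrite -sum1_card natr_sum; apply: ler_sum => phi _.
    have /negbT := none phi; rewrite negb_forall => /existsP[U].
    rewrite negb_forall => /existsP[a bad].
    rewrite (bigD1 U) //= (bigD1 a) //= -addrA.
    apply: (@le_trans _ _ ((deviates D (W U) a 1 phi)%:R + (deviates D (W U) a (-1) phi)%:R)).
      exact: ge1 bad.
    rewrite lerDl addr_ge0 //; last apply: sumr_ge0 => U' _.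
      by apply: sumr_ge0 => a' _; rewrite addr_ge0 ?ler0n.
    by apply: sumr_ge0 => a' _; rewrite addr_ge0 ?ler0n.
  have upS : S * E <= Q%:R ^+ k * (2 * Q * B)%:R.
    rewrite /S exchange_big mulr_suml.
    apply: (@le_trans _ _ (\sum_(U < B) \sum_(a < Q) (2%:R * Q%:R ^+ k))).
      apply: ler_sum => U _; rewrite exchange_big mulr_suml.
      apply: ler_sum => a _; rewrite big_split mulrDl /= mulr_natl mulr2n.
      by apply: lerD; apply: chernoff; rewrite // ?sqrrN expr1n.
    rewrite !sumr_const !card_ord; exact: double_count.
  have Qk : 0 < Q%:R ^+ k :> R by rewrite exprn_gt0 ?ltr0n.
  have : Q%:R ^+ k * E <= Q%:R ^+ k * (2 * Q * B)%:R.
    by apply: le_trans upS; apply: ler_wpM2r loS; apply: expR_ge0.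
  by rewrite ler_pM2l // leNgt E_big.
have phiQ i : ((if insub i is Some j then val (phi j) else 0) < Q)%N.
  by case: insubP => // u _ _; apply: ltn_ord.
have [v [vlt vphi]] := digit_surj k phiQ.
exists v; split=> //; apply/allP => U; rewrite mem_iota add0n => /andP[_ UB].
apply/allP => a; rewrite mem_iota add0n => /andP[_ aQ].
have [dev1 dev2] := phiP (Ordinal UB) (Ordinal aQ).
rewrite /balanced !big_mkord.
set c := (\sum_(i < k) _)%N; set w := (\sum_(i < k) _)%N.
have SE : \sum_(i < k) (W U i)%:R * (Q%:R * (phi i == Ordinal aQ)%:R - 1) =
    Q%:R * c%:R - w%:R :> R.
  rewrite /c /w !natr_sum mulr_sumr -sumrB; apply: eq_bigr => i _.
  have := vphi i (ltn_ord i); rewrite insubT //= => i_lt ->.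
  rewrite -/(W U i); have -> : phi (Sub (val i) i_lt) = phi i by congr (phi _); apply: val_inj.
  rewrite -(inj_eq val_inj) /=.
  by case: (W U i); case: (_ == a); rewrite /=; ring.
move: dev1 dev2; rewrite /deviates SE -!leNgt; exact: deviation_bounds.
Qed.

(** * Almost independence of the words *)

Definition agree k n Q (h : memory) (S : {set 'I_n}) (c : 'I_n -> 'I_Q) : nat :=
  (\sum_(i < k) [forall y in S, digit Q (h y) i == c y])%N.

Lemma selected_agree r Q n h (m : 'I_n) (S : {set 'I_n}) (c : 'I_n -> 'I_Q) :
  (0 < Q)%N -> (forall y, y \in S -> (y < m)%N) -> (#|S| < r)%N ->
  exists U, (U < (n * Q) ^ r.-1)%N /\
    forall i, selected r Q n m h U i = [forall y in S, digit Q (h y) i == c y].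
Proof.
move=> Q0 Sm Sr; set s := enum S.
have mQ (y : 'I_n) x : (x < Q)%N -> (y * Q + x < n * Q)%N.
  move=> xQ; apply: (@leq_trans (y.+1 * Q)%N); first by rewrite mulSn addnC ltn_add2r.
  by rewrite leq_mul2r ltn_ord orbT.
(* Slots beyond the size of [S] are padded with address [m], which holds no word yet and imposes
   nothing. *)
pose phi j := (if (j < size s)%N then nth m s j * Q + c (nth m s j) else m * Q + 0)%N.
have phi_lt j : (phi j < n * Q)%N by rewrite /phi; case: ifP => _; apply: mQ.
have [U [UB Uphi]] := digit_surj r.-1 phi_lt.
exists U; split=> // i; apply/allP/forall_inP => [sel y yS|ok j]; last first.
  rewrite mem_iota add0n /obeys => /andP[_ jr]; rewrite Uphi // /phi.
  case: ltnP => js; last by rewrite addn0 mulnK // leqnn.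
  have yS : nth m s j \in S by rewrite -mem_enum mem_nth.
  rewrite divnMDl // divn_small // addn0 modnMDl modn_small //.
  by rewrite ok // orbT.
have ys : y \in s by rewrite mem_enum.
have js : (index y s < size s)%N by rewrite index_mem.
have jr : (index y s < r.-1)%N.
  by move: js; rewrite /s -cardE; lia.
have := sel (index y s); rewrite mem_iota add0n jr => /(_ isT).
rewrite /obeys Uphi // /phi js nth_index //.
rewrite divnMDl // divn_small // addn0 modnMDl modn_small //.
by rewrite leqNgt Sm.
Qed.

Lemma agree_step r Q D k n h (m : 'I_n) (S : {set 'I_n}) (c : 'I_n -> 'I_Q) :
  (0 < Q)%N -> good_word r Q D k n m h (h m) ->
  (forall y, y \in S -> (y < m)%N) -> (#|S| < r)%N ->
  (D * (Q * agree k h (m |: S) c) <= D * agree k h S c + k)%N /\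
  (D * agree k h S c <= D * (Q * agree k h (m |: S) c) + k)%N.
Proof.
move=> Q0 /allP good Sm Sr; have [U [UB selU]] := selected_agree h c Q0 Sm Sr.
have /good/allP/(_ (c m)) : U \in iota 0 ((n * Q) ^ r.-1) by rewrite mem_iota.
rewrite mem_iota add0n ltn_ord => /(_ isT) /andP; rewrite !big_mkord.
have -> : (\sum_(i < k) selected r Q n m h U i)%N = agree k h S c.
  by apply: eq_bigr => i _; rewrite selU.
suff -> : (\sum_(i < k) (selected r Q n m h U i && (digit Q (h m) i == c m)))%N =
    agree k h (m |: S) c by [].
apply: eq_bigr => i _; congr nat_of_bool; rewrite selU.
apply/andP/forall_inP => [[/forall_inP ok okm] y|ok].
  by rewrite !inE => /orP[/eqP ->|/ok].
split; last by apply: ok; rewrite !inE eqxx.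
by apply/forall_inP => y yS; apply: ok; rewrite !inE yS orbT.
Qed.

(** Removing the largest index, whose word was chosen last, allows [agree_step]. Writing s for the
    size of [S] and N_s for the count, Q^s N_s - k = Q^(s-1) (Q N_s - N_(s-1)) + (Q^(s-1) N_(s-1) -
    k), and the errors add up. *)
Lemma agree_bound (R : realType) r Q D k n h (S : {set 'I_n}) (c : 'I_n -> 'I_Q) :
  (0 < Q)%N -> (0 < D)%N -> (forall m : 'I_n, good_word r Q D k n m h (h m)) ->
  (#|S| <= r)%N ->
  `|Q%:R ^+ #|S| * (agree k h S c)%:R - k%:R| <= #|S|%:R * Q%:R ^+ #|S| * k%:R / D%:R :> R.
Proof.
move=> Q0 D0 good; have [s] := ubnP #|S|; elim: s S => // s IH S sS Sr.
have D1 : 0 < D%:R :> R by rewrite ltr0n.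
have [->|[m0 m0S]] := set_0Vmem S.
  rewrite cards0 expr0 mul1r mul0r mul0r /agree (eq_bigr (fun=> 1%N)) => [|i _].
    by rewrite sum1_card card_ord subrr normr0 mul0r.
  by apply/eqP; rewrite eqb1; apply/forall_inP => y; rewrite inE.
have [m mS mmax] := arg_maxnP (fun y : 'I_n => nat_of_ord y) m0S.
have {}mS : m \in S by [].
have {}mmax y : y \in S -> (y <= m)%N := mmax y.
pose S' := S :\ m.
have SE : m |: S' = S by rewrite setD1K.
have cS : #|S| = #|S'|.+1 by rewrite (cardsD1 m S) mS.
have Sm y : y \in S' -> (y < m)%N.
  rewrite !inE => /andP[ym yS]; rewrite ltn_neqAle.
  by rewrite mmax // andbT; apply: contra ym => /eqP/val_inj ->.
have S'r : (#|S'| < r)%N by rewrite -cS.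
have [] := agree_step c Q0 (good m) Sm S'r; rewrite SE => up lo.
have {}IH := IH S' ltac:(lia) (ltnW S'r).
set N := agree k h S c in up lo *; set N' := agree k h S' c in up lo IH.
have step : `|Q%:R * N%:R - N'%:R| <= k%:R / D%:R :> R.
  move: up lo; rewrite -!(ler_nat R) !natrD !natrM => up lo.
  rewrite ler_pdivlMr // -[D%:R in leLHS]gtr0_norm // -normrM ler_norml.
  by apply/andP; split; lra.
rewrite cS exprS; set q : R := Q%:R in step IH *.
have q1 : 1 <= q by rewrite ler1n.
set x := q ^+ #|S'| in IH *.
have x0 : 0 <= x by rewrite exprn_ge0 //; lra.
have -> : q * x * N%:R - k%:R = x * (q * N%:R - N'%:R) + (x * N'%:R - k%:R) by ring.
apply: le_trans (ler_normD _ _) _; rewrite normrM (ger0_norm x0).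
apply: le_trans (lerD (ler_wpM2l x0 step) IH) _.
rewrite -natr1.
have kD : 0 <= k%:R / D%:R :> R by rewrite divr_ge0 ?ler0n.
have -> : #|S'|%:R * x * k%:R / D%:R = #|S'|%:R * x * (k%:R / D%:R) by rewrite mulrA.
have -> : (#|S'|%:R + 1) * (q * x) * k%:R / D%:R =
  q * (x * (k%:R / D%:R) + #|S'|%:R * x * (k%:R / D%:R)).
  by ring.
apply: ler_peMl => //; apply: addr_ge0; first exact: mulr_ge0.
by apply: mulr_ge0 => //; apply: mulr_ge0.
Qed.

(** * Approximating the exponential law *)

(* The coefficient of ['X^r] in a product of truncated exponential series. *)
Lemma multinomial (R : realType) n r (z : 'I_n -> R) :
  (\sum_m z m) ^+ r = r`!%:R *
  \sum_(a : {ffun 'I_n -> 'I_r.+1} | (\sum_(m < n) a m)%N == r)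
    \prod_(m < n) (z m ^+ a m / (a m)`!%:R).
Proof.
pose E (x : R) : {poly R} := \poly_(j < r.+1) (x ^+ j / j`!%:R).
have fact0 j : j`!%:R != 0 :> R by rewrite pnatr_eq0 -lt0n fact_gt0.
have [_ /(_ r (leqnn r)) coefE] : True /\ forall i, (i <= r)%N ->
    (\prod_(m < n) E (z m))`_i = (\sum_m z m) ^+ i / i`!%:R.
  split=> //; elim/big_rec2: _ => [|m x p _ IH] i ir.
    by case: i {ir} => [|i]; rewrite coef1 ?expr0 ?divr1 // expr0n mul0r.
  rewrite coefM [in RHS]addrC exprDn mulr_suml; apply: eq_bigr => j _.
  have ji : (j <= i)%N by rewrite -ltnS.
  rewrite coef_poly ltnS (leq_trans ji ir) IH ?(leq_trans (leq_subr _ _)) //.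
  have C0 : 'C(i, j)%:R != 0 :> R by rewrite pnatr_eq0 -lt0n bin_gt0.
  rewrite -(bin_fact ji) !natrM -mulr_natr.
  by field; rewrite C0 !fact0.
have distr : \prod_(m < n) E (z m) = \sum_(a : {ffun 'I_n -> 'I_r.+1})
    (\prod_(m < n) (z m ^+ a m / (a m)`!%:R)) *: 'X^(\sum_(m < n) a m)%N.
  rewrite (eq_bigr _ (fun m _ => poly_def _ _)) bigA_distr_bigA /=.
  apply: eq_bigr => a _; rewrite scaler_prod.
  by congr (_ *: _); rewrite -expr_sum.
move: coefE; rewrite distr coef_sum => coefE.
have -> : \sum_(a : {ffun 'I_n -> 'I_r.+1} | (\sum_(m < n) a m)%N == r)
    \prod_(m < n) (z m ^+ a m / (a m)`!%:R) = (\sum_m z m) ^+ r / r`!%:R.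
  rewrite -coefE big_mkcond; apply: eq_bigr => a _.
  by rewrite coefZ coefXn eq_sym; case: eqP; rewrite ?mulr1 ?mulr0.
by rewrite mulrC divfK.
Qed.

(** Sort the (a+b+1)-subsets of {0, ..., T} by their element i that has a elements below it and b
    above. *)
Lemma bin_convolution T a b :
  (\sum_(0 <= i < T.+1) 'C(i, a) * 'C(T - i, b) = 'C(T.+1, (a + b).+1))%N.
Proof.
elim: T b => [|T IH] b.
  by rewrite big_nat1; case: a b => [|a] [|b].
case: b => [|b]; rewrite big_nat_recr //= subnn.
  rewrite addn0 binS; have := IH 0%N; rewrite addn0 => <-; rewrite bin0 muln1; congr (_ + _)%N.
  by apply: eq_bigr => i _; rewrite !bin0.
rewrite muln0 addn0 addnS binS -{1}addnS -!IH -big_split /= !big_nat.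
apply: eq_bigr => i /andP[_ iT]; rewrite ltnS in iT.
by rewrite -mulnDr -binS subSn.
Qed.

(** This is the convolution at i = j + d; the missing terms i < d vanish because d <= a. *)
Lemma sum_bin_shift M N a d : (d <= a)%N ->
  (\sum_(0 <= j < M.+1) 'C(j + d, a) * 'C(M - j, N) = 'C(M + d.+1, (a + N).+1))%N.
Proof.
move=> da; rewrite addnS -bin_convolution.
have -> : ((M + d).+1 = M.+1 + d)%N by rewrite addSn.
rewrite (addnC M.+1) [RHS](big_cat_nat (n := d)) ?leq_addr //=.
rewrite [X in (_ = X + _)%N]big1_seq ?add0n => [|i]; last first.
  rewrite mem_index_iota => /= id; rewrite bin_small //; lia.
rewrite -{2}[d]add0n (addnC d) big_addn addnK.
by apply: eq_bigr => j _; rewrite subnDr.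
Qed.

Lemma leq_exp_ffact j e : (j.+1 ^ e <= (j + e) ^_ e)%N.
Proof.
elim: e => [|e IH] //; rewrite addnS ffactSS expnS; apply: leq_mul IH; lia.
Qed.

Lemma leq_ffact_exp n e : (n ^_ e <= n ^ e)%N.
Proof.
elim: e => [|e IH] //; rewrite ffactnSr expnSr; apply: leq_mul IH _.
exact: leq_subr.
Qed.

(** ['C(M - j, N)] counts the (N+1)-subsets of {0, ..., M} with minimum j, and a rescaled minimum of
    many random points is nearly exponential. *)
Definition power_sum M N e := (\sum_(0 <= j < M.+1) j.+1 ^ e * 'C(M - j, N))%N.

Lemma power_sum0 M N : power_sum M N 0 = 'C(M.+1, N.+1).
Proof.
have := sum_bin_shift M N (leqnn 0); rewrite add0n addn1 => <-.
by apply: eq_bigr => j _; rewrite addn0 bin0.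
Qed.

(** Bounds on quotients of binomials are proved cross-multiplied in [nat]: the ratio c'/c = B/A of
    neighbours is at most y/x. *)
Lemma ratio_step_le A B c c' q x y e : (A * c' = B * c -> x <= A -> B <= y ->
  c * x ^ e <= q * y ^ e -> c' * x ^ e.+1 <= q * y ^ e.+1)%N.
Proof.
move=> AB xA By le; rewrite !expnS mulnCA [leqRHS]mulnCA.
apply: (@leq_trans (A * (c' * x ^ e))%N); first by rewrite leq_mul2r xA orbT.
by rewrite mulnA AB -mulnA; apply: leq_mul.
Qed.

Lemma ratio_step_ge A B c c' q x y e : (A * c' = B * c -> x <= B -> A <= y ->
  q * x ^ e <= c * y ^ e -> q * x ^ e.+1 <= c' * y ^ e.+1)%N.
Proof.
move=> AB xB Ay le; rewrite !expnS mulnCA [leqRHS]mulnCA.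
apply: (@leq_trans (A * (c' * y ^ e))%N); last by rewrite leq_mul2r Ay orbT.
by rewrite [leqRHS]mulnA AB -mulnA; apply: leq_mul.
Qed.

(** Replacing (j+1)^e by the larger e! C(j+e, e) makes the sum a single binomial, then compared with
    C(M+1, N+1) along a diagonal. *)
Lemma power_sum_le M N r e : (e <= r)%N ->
  (power_sum M N e * N.+1 ^ e <= e`! * power_sum M N 0 * (M.+1 + r) ^ e)%N.
Proof.
move=> er; apply: (@leq_trans (e`! * 'C(M + e.+1, (e + N).+1) * N.+1 ^ e)%N).
  rewrite leq_mul2r -sum_bin_shift // big_distrr /=; apply/orP; right.
  apply: leq_sum => j _; rewrite mulnA leq_mul2r; apply/orP; right.
  by rewrite mulnC bin_ffact leq_exp_ffact.
rewrite -!mulnA leq_mul2l power_sum0; apply/orP; right.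
elim: e er => [|e IH] er; first by rewrite addn1.
have := mul_bin_diag (M + e.+2) (e + N).+1; rewrite [_.-1]/= addnS /= => diag.
by apply: ratio_step_le (esym diag) _ _ (IH (ltnW er)); lia.
Qed.

(** Here (j+1)^e is replaced by the smaller e! C(j+1, e). The shift by 1 in [sum_bin_shift] requires
    e >= 1, so e = 0 is apart. *)
Lemma power_sum_ge M N r e : (e <= r)%N ->
  (e`! * power_sum M N 0 * (M - N - r) ^ e <= power_sum M N e * (N + r).+1 ^ e)%N.
Proof.
case: e => [|e] er; first by rewrite !mul1n !muln1.
apply: (@leq_trans (e.+1`! * 'C(M + 2, (e.+1 + N).+1) * (N + r).+1 ^ e.+1)%N); last first.
  rewrite leq_mul2r -(@sum_bin_shift M N e.+1 1) // big_distrr /=; apply/orP; right.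
  apply: leq_sum => j _; rewrite mulnA leq_mul2r; apply/orP; right.
  by rewrite mulnC addn1 bin_ffact leq_ffact_exp.
move: (factorial e.+1) => F; rewrite -!mulnA leq_mul2l power_sum0; apply/orP; right.
elim: e er => [|e IH] er.
  rewrite !expn1 addn2 add1n; have := mul_bin_diag M.+2 N.+1; rewrite -[M.+2.-1]/M.+1 => diag.
  apply: (@leq_trans (M.+2 * 'C(M.+1, N.+1))%N); first by rewrite [leqLHS]mulnC leq_mul2r; lia.
  by rewrite diag [leqRHS]mulnC leq_mul2r; lia.
have left := mul_bin_left (M + 2) (e.+1 + N).+1.
by apply: ratio_step_ge left _ _ (IH (ltnW er)); lia.
Qed.

Definition moment (R : realType) (tbl : seq nat) (w e : nat) : R :=
  (\sum_(x < size tbl) ((nth 0%N tbl x)%:R / w%:R) ^+ e) / (size tbl)%:R.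

(* The law of [(j + 1) (N + 1) / (M + 1)], with [j] of weight ['C(M - j, N)], is
   close to the standard exponential law, whose moments are the factorials. *)
Lemma exponential_table (R : realType) r (dl : R) : 0 < dl -> dl <= 1 ->
  exists tbl w, [/\ (0 < size tbl)%N, (0 < w)%N & forall e, (e <= r)%N ->
    e`!%:R * (1 - dl) ^+ e <= moment R tbl w e <= e`!%:R * (1 + dl) ^+ e].
Proof.
move=> dl0 dl1; pose N := Num.bound (r.+1%:R / dl).
have N_big : r.+1%:R / dl < N%:R by rewrite archi_boundP // divr_ge0 ?ler0n ?ltW.
(* The upper error is then 1 + r/P^2 and the lower one (1 - 1/P)(1 - r/P) >= 1 - (r+1)/P, both
   within [dl] as P > N > (r+1)/dl. *)
pose P := (N + r).+1; pose M := (P ^ 2).-1.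
have MP : M.+1 = (P ^ 2)%N by rewrite /M prednK // expn_gt0.
pose tbl := flatten [seq nseq 'C(M - j, N) (j.+1 * N.+1)%N | j <- index_iota 0 M.+1].
have sum_tbl (F : nat -> R) : \sum_(x < size tbl) F (nth 0%N tbl x) =
    \sum_(0 <= j < M.+1) F (j.+1 * N.+1)%N *+ 'C(M - j, N).
  rewrite -(big_mkord predT (fun x => F (nth 0%N tbl x))) -(big_nth 0%N predT F).
  rewrite big_flatten big_map; apply: eq_bigr => j _.
  by rewrite big_nseq -Monoid.iteropE /=; elim: 'C(_, _).
have size_tbl : size tbl = power_sum M N 0.
  apply/eqP; rewrite -(eqr_nat R) -[in X in X == _](card_ord (size tbl)) -sum1_card natr_sum.
  rewrite (sum_tbl (fun=> 1)) natr_sum; apply/eqP; apply: eq_bigr => j _.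
  by rewrite expn0 mul1n.
have size0 : (0 < size tbl)%N.
  rewrite size_tbl power_sum0 bin_gt0 ltnS.
  by have : (N < P ^ 2)%N by rewrite /P -mulnn; nia; rewrite -MP.
exists tbl, M.+1; split=> // e er; rewrite /moment.
rewrite (sum_tbl (fun x => (x%:R / M.+1%:R) ^+ e)).
have -> : \sum_(0 <= j < M.+1) ((j.+1 * N.+1)%:R / M.+1%:R) ^+ e *+ 'C(M - j, N) =
    (power_sum M N e)%:R * (N.+1%:R / M.+1%:R) ^+ e :> R.
  rewrite natr_sum mulr_suml; apply: eq_bigr => j _.
  by rewrite natrM [in RHS]natrM natrX -[LHS]mulr_natr -[X in X ^+ e * _]mulrA exprMn mulrAC.
have q0 : 0 < (size tbl)%:R :> R by rewrite ltr0n.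
have up := power_sum_le M N er; have lo := power_sum_ge M N er.
rewrite -size_tbl -(ler_nat R) !natrM !natrX natrD in up.
rewrite -size_tbl -(ler_nat R) !natrM !natrX in lo.
have M0 : 0 < M.+1%:R :> R by rewrite ltr0n.
have P0 : 0 < P%:R :> R by rewrite ltr0n.
have rP : r.+1%:R <= dl * P%:R.
  rewrite mulrC -ler_pdivrMr //; apply: le_trans (ltW N_big) _.
  by rewrite ler_nat /P; lia.
have P1 : 1 <= P%:R :> R by rewrite ler1n.
have MR : M.+1%:R = P%:R ^+ 2 :> R by rewrite MP natrX.
have NR : N.+1%:R = P%:R - r%:R :> R by rewrite /P -addSn natrD addrK.
have r1 : r.+1%:R = r%:R + 1 :> R by rewrite natr1.
have r0 : 0 <= r%:R :> R by rewrite ler0n.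
set S := (power_sum M N e)%:R in up lo *; set q := (size tbl)%:R in q0 up lo *.
rewrite ler_pdivlMr // ler_pdivrMr // !(mulrAC _ _ q).
apply/andP; split; last first.
  rewrite expr_div_n mulrA ler_pdivrMr ?exprn_gt0 //; apply: le_trans up _.
  rewrite -[leRHS]mulrA -exprMn; apply: ler_wpM2l; first by rewrite mulr_ge0 // ltW.
  apply: lerXn2r; rewrite ?nnegrE; first by rewrite addr_ge0 ?ler0n.
    by apply: mulr_ge0; [lra | exact: ltW].
  rewrite mulrDl mul1r lerD2l MR; nra.
have subE : (M - N - r)%:R = P%:R ^+ 2 - P%:R :> R.
  rewrite -MR -natrB; last by rewrite MP -mulnn leq_pmull.
  by congr (_%:R); rewrite /P subSS subnDA.
rewrite subE -/P in lo.
have PP0 : 0 < P%:R ^+ e :> R by rewrite exprn_gt0.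
rewrite -(ler_pM2r PP0) [leRHS]mulrAC; apply: le_trans (ler_wpM2r _ lo); last first.
  by rewrite exprn_ge0 // divr_ge0.
rewrite -![in leLHS]mulrA -![in leRHS]mulrA -!exprMn; apply: ler_wpM2l => //.
apply: ler_wpM2l; first exact: ltW.
apply: lerXn2r; rewrite ?nnegrE.
- by apply: mulr_ge0; lra.
- by apply: mulr_ge0; [nra | rewrite divr_ge0].
rewrite MR NR mulrA ler_pdivlMr ?exprn_gt0 //.
have -> : (1 - dl) * P%:R * P%:R ^+ 2 = (P%:R * (P%:R - dl * P%:R)) * P%:R by ring.
have -> : (P%:R ^+ 2 - P%:R) * (P%:R - r%:R) = ((P%:R - 1) * (P%:R - r%:R)) * P%:R :> R by ring.
have rPP := ler_wpM2r (ltW P0) rP; rewrite r1 in rPP.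
apply: ler_wpM2r; first exact: ltW.
by rewrite !mulrBl !mulrBr; lra.
Qed.

(** * The linear forms *)

Lemma columns_le_ln (R : realType) r A n : (0 < r)%N -> (1 < n)%N ->
  (columns r A n)%:R <= A%:R * 2 ^+ r / ln 2 * ln n%:R :> R.
Proof.
move=> r0 n1; have [nL ltT] := root_logP n r0.
have ln2 : 0 < ln 2 :> R by rewrite ln_gt0 // ltr1n.
have n_gt0 : 0 < n%:R :> R by rewrite ltr0n ltnW.
have T2 : (1 < root_log r n)%N.
  by move: nL; case: (root_log r n) => [|[|t]] //; rewrite ?exp0n ?exp1n //; lia.
set T := root_log r n in nL ltT T2 *.
have pow : (2 ^ (T ^ r) <= n ^ (2 ^ r))%N.
  apply: (@leq_trans ((2 ^ (T.-1 ^ r)) ^ (2 ^ r))%N).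
    by rewrite -expnM leq_exp2l // -expnMn expn_mono //; lia.
  by apply/expn_mono/ltT; rewrite prednK // ltnW.
have le : (T ^ r)%:R * ln 2 <= 2 ^+ r * ln n%:R :> R.
  rewrite [leLHS]mulr_natl -natrX [leRHS]mulr_natl -!lnXn ?ltr0n ?(ltnW n1) //.
  by rewrite -!natrX ler_ln ?posrE ?ltr0n ?expn_gt0 ?(ltnW n1) // ler_nat.
rewrite /columns natrM -!mulrA; apply: ler_wpM2l => //.
by rewrite mulrA mulrAC -(ler_pM2r ln2) divfK // gt_eqF.
Qed.

(** It allows the heap seen when word m was chosen to be replaced by the final memory. *)
Lemma eq_good_word r Q D k n m h h' v : (forall a, (a < m)%N -> h a = h' a) ->
  good_word r Q D k n m h v = good_word r Q D k n m h' v.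
Proof.
move=> eqh; have eqs U i : selected r Q n m h U i = selected r Q n m h' U i.
  apply: eq_all => j; rewrite /obeys; case: leqP => //= ym.
  by rewrite eqh.
apply: eq_all => U; apply: eq_all => a; rewrite /balanced.
rewrite (eq_bigr _ (fun i _ => congr1 nat_of_bool (eqs U i))).
by rewrite (eq_bigr _ (fun i _ => congr1 (fun b => nat_of_bool (b && _)) (eqs U i))).
Qed.

Lemma construction (R : realType) r Q D A s Z tbl :
  (0 < r)%N -> (0 < Q)%N -> (0 < D)%N -> (0 < Z)%N ->
  (8 * D ^ 2 * Q ^ 2 * (2 * Q ^ r.+1 * 2 ^ r) <= A)%N ->
  exists P, constructs_in_polytime P (fun n M =>
    [/\ M 0%N = columns r A n, (0 < root_log r n)%N & exists h : memory,
      (forall m : 'I_n, good_word r Q D (columns r A n) n m h (h m)) /\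
      (forall i j m, (i < columns r A n)%N -> (j < s)%N -> (m < n)%N ->
        output_entry R M ((i * s + j) * n + m) =
        (nth 0%N tbl (j * Q + digit Q (h m) i))%:R / (root_log r n * Z)%:R)]).
Proof.
move=> r0 Q0 D0 Z0 Abig.
have [P [W [e HP]]] := algorithm_spec D A s Z tbl r0 Q0.
(* As n >= 2, n + 2 <= 2n. *)
exists P, (2 ^ e)%N, e => n n1; have n0 : (0 < n)%N by apply: ltnW.
have [t [M [exM tle [M0 M1 words entries]]]] := HP n n0.
have T0 : (0 < root_log r n)%N.
  have [nL _] := root_logP n r0; move: nL; case: (root_log r n) => //.
  by rewrite exp0n //; lia.
exists t, M; split=> //.
  apply: leq_trans tle _; rewrite -expnMn; apply: expn_mono; lia.
split=> //; exists (fun a => M (W + a)%N); split=> [m|i j m ik js mn].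
  have [h [eqh wordE]] := words m (ltn_ord m).
  rewrite -(@eq_good_word _ _ _ _ _ _ h) // wordE /next_word.
  have [v [vlt good]] := @exists_good_word R r Q D A n m h r0 Q0 D0 n0 Abig.
  have has_good : has (good_word r Q D (columns r A n) n m h)
      (iota 0 (Q ^ columns r A n)).
    by apply/hasP; exists v => //; rewrite mem_iota.
  have := nth_find 0%N has_good; rewrite nth_iota ?add0n //.
  by rewrite -[ltnRHS](size_iota 0) -has_find.
have [e0 e1 e2] := entries i j m ik js mn.
rewrite /output_entry e0 e1 e2 subr0 prednK // muln_gt0 T0; exact: Z0.
Qed.

Lemma natr_forall (R : realType) n (p : pred 'I_n) :
  [forall m, p m]%:R = \prod_(m < n) (p m)%:R :> R.
Proof.
case: forallP => [ok|nok]; first by rewrite big1 // => m _; rewrite ok.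
have /existsP[m] : [exists m, ~~ p m].
  by rewrite -negb_forall; apply/negP => /forallP.
by move=> /negbTE pm; rewrite (bigD1 m) //= pm mul0r.
Qed.

(** Both sides become sums over all letter assignments c, weighted by the same nonnegative monomial
    in the values X(c m). Only the support S of [a], of size at most r, constrains the columns, so
    [agree_bound] applies termwise and yields a relative error. *)
Lemma agree_average (R : realType) r Q D k n h (X : nat -> R)
    (a : {ffun 'I_n -> 'I_r.+1}) :
  (0 < Q)%N -> (0 < D)%N -> (forall x, 0 <= X x) ->
  (forall m : 'I_n, good_word r Q D k n m h (h m)) -> (\sum_(m < n) a m)%N = r ->
  forall mean, mean = \prod_(m < n) ((\sum_(x < Q) X x ^+ a m) / Q%:R) ->
  `|\sum_(i < k) \prod_(m < n) X (digit Q (h m) i) ^+ a m - k%:R * mean| <=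
    (r%:R * Q%:R ^+ r / D%:R) * (k%:R * mean).
Proof.
move=> Q0 D0 X0 good sum_a mean meanE.
pose S := [set m | a m != 0%N :> nat].
have Sr : (#|S| <= r)%N.
  rewrite -sum_a -sum1_card big_mkcond; apply: leq_sum => m _.
  by rewrite inE; case: (a m : nat).
pose Phi (c : {ffun 'I_n -> 'I_Q}) := \prod_(m < n) X (c m) ^+ a m.
have Phi0 c : 0 <= Phi c by apply: prodr_ge0 => m _; apply: exprn_ge0.
pose K : R := \prod_(m < n) (if m \in S then 1 else Q%:R).
have Qr : 0 < Q%:R :> R by rewrite ltr0n.
have KQ : Q%:R ^+ #|S| * K = Q%:R ^+ n.
  rewrite -prodr_const big_mkcond -big_split /=.
  rewrite (eq_bigr (fun=> Q%:R)) ?prodr_const ?card_ord // => m _.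
  by case: ifP; rewrite ?mulr1 ?mul1r.
set F := \sum_(i < k) _.
have PhiE : \sum_c Phi c = Q%:R ^+ n * mean.
  rewrite /Phi -(bigA_distr_bigA (fun m (x : 'I_Q) => X x ^+ a m)) meanE.
  rewrite prodf_div prodr_const card_ord mulrC divfK //.
  by rewrite expf_neq0 // gt_eqF.
have FE : Q%:R ^+ n * F = \sum_(c : {ffun 'I_n -> 'I_Q}) Q%:R ^+ #|S| * (agree k h S c)%:R * Phi c.
  rewrite -KQ -mulrA; under eq_bigr do rewrite -mulrA.
  rewrite -mulr_sumr; congr (_ * _); rewrite /F mulr_sumr.
  under [RHS]eq_bigr do rewrite natr_sum mulr_suml.
  rewrite exchange_big; apply: eq_bigr => i _.
  under [RHS]eq_bigr do rewrite natr_forall -big_split.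
  rewrite -(bigA_distr_bigA (fun m (x : 'I_Q) =>
    ((m \in S) ==> (digit Q (h m) i == x))%:R * X x ^+ a m)) -big_split /=.
  apply: eq_bigr => m _; case: ifP => mS.
    have dQ : (digit Q (h m) i < Q)%N by rewrite ltn_mod.
    rewrite (bigD1 (Ordinal dQ)) //= eqxx !mul1r big1 ?addr0 // => x xd.
    by rewrite eq_sym (inj_eq val_inj x (Ordinal dQ)) (negbTE xd) mul0r.
  have -> : a m = 0%N :> nat by move: mS; rewrite inE => /negbFE/eqP.
  by under [RHS]eq_bigr do rewrite mul1r; rewrite sumr_const card_ord mulr1.
have Qn0 : 0 < Q%:R ^+ n :> R by rewrite exprn_gt0.
rewrite -(ler_pM2l Qn0) -[X in X * `|_|](gtr0_norm Qn0) -normrM mulrBr FE.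
rewrite !(mulrCA (Q%:R ^+ n)) -PhiE !mulr_sumr -sumrB.
apply: le_trans (ler_norm_sum _ _ _) _; apply: ler_sum => c _.
rewrite -mulrBl normrM (ger0_norm (Phi0 c)) [leRHS]mulrA; apply: ler_wpM2r => //.
apply: le_trans (agree_bound R c Q0 D0 good Sr) _.
rewrite -!mulrA [(k%:R / _)]mulrC; apply: ler_pM => //.
- by rewrite !mulr_ge0 ?exprn_ge0 ?invr_ge0 // ltW.
- by rewrite ler_nat.
apply: ler_wpM2r; first by rewrite mulr_ge0 ?invr_ge0.
by apply: ler_weXn2l => //; rewrite ler1n.
Qed.

(** * Choice of the constants *)

(** The absolute value covers eps > 1 with even r, where (1 - eps)^r is |1 - eps|^r. The squares
    leave room for two errors: that of the words and that of the moments. *)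
Lemma scale_choice (R : realType) (eps : R) : 0 < eps ->
  exists (p q : nat) (dl : R), [/\ (0 < q)%N, 0 < dl, dl <= 1,
    `|1 - eps| <= p%:R / q%:R * (1 - dl) ^+ 2 &
    p%:R / q%:R * (1 + dl) ^+ 2 <= 1 + eps].
Proof.
move=> eps0; set lo := `|1 - eps|; set hi := 1 + eps.
have lo0 : 0 <= lo by apply: normr_ge0.
have lohi : lo < hi by rewrite /lo /hi lter_norml; apply/andP; split; lra.
pose q := (Num.bound (1 / (hi - lo))).+1.
have q0 : 0 < q%:R :> R by rewrite ltr0n.
have gap : 1 < q%:R * (hi - lo).
  rewrite -ltr_pdivrMr ?subr_gt0 //.
  have h0 : 0 <= 1 / (hi - lo) by rewrite divr_ge0 // subr_ge0 ltW.
  by apply: lt_trans (archi_boundP h0) _; rewrite ltr_nat.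
pose p := (Num.truncn (q%:R * lo)).+1.
have /andP[p_lo p_hi] : (p.-1)%:R <= q%:R * lo < p%:R.
  by apply: truncn_itv; rewrite mulr_ge0 // ltW.
have pE : p%:R = p.-1%:R + 1 :> R by rewrite natr1.
set c : R := p%:R / q%:R.
have lo_c : lo < c by rewrite /c ltr_pdivlMr // mulrC p_hi.
have c_hi : c < hi by rewrite /c ltr_pdivrMr // pE; nra.
have c0 : 0 < c by apply: le_lt_trans lo_c.
(* The divisors 2 and 3 come from (1 - dl)^2 >= 1 - 2 dl and, for dl <= 1, (1 + dl)^2 <= 1 + 3
   dl. *)
pose dl := Num.min 1 (Num.min ((c - lo) / (2 * c)) ((hi - c) / (3 * c))).
have dl0 : 0 < dl by rewrite /dl !lt_min ltr01 !divr_gt0 ?subr_gt0 //; lra.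
have dl1 : dl <= 1 by rewrite /dl !ge_min lexx.
have c2 : 0 < 2 * c by lra.
have c3 : 0 < 3 * c by lra.
have dl_lo : dl * (2 * c) <= c - lo.
  by rewrite -ler_pdivlMr // /dl !ge_min lexx !orbT.
have dl_hi : dl * (3 * c) <= hi - c.
  by rewrite -ler_pdivlMr // /dl !ge_min lexx !orbT.
exists p, q, dl; split=> //; rewrite -/c.
  have : 0 <= c * dl ^+ 2 by rewrite mulr_ge0 ?sqr_ge0 // ltW.
  rewrite expr2 in dl_lo * => ?; lra.
have : c * dl ^+ 2 <= c * dl.
  by apply: ler_wpM2l; [exact: ltW | rewrite expr2 ler_piMr // ltW].
by rewrite !expr2 => ?; lra.
Qed.

Lemma expr_bounds (R : realType) (c dl eps : R) r : (0 < r)%N -> 0 <= c ->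
  0 < dl -> dl <= 1 -> `|1 - eps| <= c * (1 - dl) ^+ 2 ->
  c * (1 + dl) ^+ 2 <= 1 + eps ->
  (1 - eps) ^+ r <= c ^+ r * ((1 - dl) * (1 - dl) ^+ r) /\
  c ^+ r * ((1 + dl) * (1 + dl) ^+ r) <= (1 + eps) ^+ r.
Proof.
move=> r0 c0 dl0 dl1 lo hi; split.
  apply: le_trans (ler_norm _) _; rewrite normrX.
  apply: (@le_trans _ _ ((c * (1 - dl) ^+ 2) ^+ r)).
    by apply: lerXn2r; rewrite // nnegrE ?normr_ge0 // mulr_ge0 ?sqr_ge0.
  rewrite exprMn -exprM mulnC exprM expr2.
  apply: ler_wpM2l; first exact: exprn_ge0.
  apply: ler_wpM2r; first by rewrite exprn_ge0 // subr_ge0.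
  by apply: ler_iXnr => //; lra.
apply: (@le_trans _ _ ((c * (1 + dl) ^+ 2) ^+ r)); last first.
  have h0 : 0 <= c * (1 + dl) ^+ 2 by rewrite mulr_ge0 ?sqr_ge0.
  by apply: lerXn2r; rewrite // nnegrE // (le_trans h0).
rewrite exprMn -exprM mulnC exprM expr2.
apply: ler_wpM2l; first exact: exprn_ge0.
apply: ler_wpM2r; first by rewrite exprn_ge0 //; lra.
by apply: ler_eXnr => //; lra.
Qed.

(* The number of columns is chosen so that the normalisation is an exact
   [r]-th power, hence can be distributed over the linear forms. *)
Definition column_factor r A := (r`! ^ r.-1 * A ^ r)%N.

Lemma normalisation (R : realType) r A T (c : R) : (0 < r)%N -> (0 < A)%N -> (0 < T)%N ->
  r`!%:R * (c / (T * (r`! * A))%:R) ^+ r * (column_factor r A * T ^ r)%:R = c ^+ r.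
Proof.
move=> r0 A0 T0; rewrite expr_div_n -natrX.
have -> : ((T * (r`! * A)) ^ r = r`! * (column_factor r A * T ^ r))%N.
  have fE : (r`! ^ r = r`! * r`! ^ r.-1)%N by rewrite -expnS prednK.
  by rewrite !expnMn fE /column_factor mulnC !mulnA.
rewrite natrM; set x := (_ * _)%:R; field.
by rewrite !pnatr_eq0 -!lt0n fact_gt0 !muln_gt0 !expn_gt0 fact_gt0 A0 T0.
Qed.

Lemma column_factor_ge r A : (0 < r)%N -> (A <= column_factor r A)%N.
Proof.
move=> r0; case: A => // A; apply: (@leq_trans (A.+1 ^ r)%N).
  by rewrite -{1}(expn1 A.+1) leq_pexp2l.
by rewrite leq_pmull // expn_gt0 fact_gt0.
Qed.

Lemma accuracy_parameters (R : realType) r Q (dl : R) : (0 < r)%N -> (0 < Q)%N -> 0 < dl ->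
  exists D B, [/\ (0 < D)%N, (0 < B)%N, r%:R * Q%:R ^+ r / D%:R <= dl &
    (8 * D ^ 2 * Q ^ 2 * (2 * Q ^ r.+1 * 2 ^ r) <= column_factor r B)%N].
Proof.
move=> r0 Q0 dl0; pose x := r%:R * Q%:R ^+ r / dl.
have x0 : 0 <= x by rewrite divr_ge0 ?mulr_ge0 ?exprn_ge0 // ltW.
pose D := (Num.bound x).+1.
exists D, (8 * D ^ 2 * Q ^ 2 * (2 * Q ^ r.+1 * 2 ^ r))%N; split=> //.
- by rewrite !muln_gt0 !expn_gt0 Q0.
- rewrite ler_pdivrMr ?ltr0n // [leRHS]mulrC -ler_pdivrMr //.
  by apply: le_trans (ltW (archi_boundP x0)) _; rewrite ler_nat.
exact: column_factor_ge.
Qed.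

Lemma relative_error (R : realType) (x y d dl : R) :
  0 <= y -> d <= dl ->
  `|x - y| <= d * y -> (1 - dl) * y <= x <= (1 + dl) * y.
Proof.
move=> y0 ddl; rewrite ler_norml => /andP[lo hi].
have : d * y <= dl * y by apply: ler_wpM2r.
by move=> le; apply/andP; split; lra.
Qed.

Lemma scaled_bounds (R : realType) r (c dl eps s k u f : R) :
  (0 < r)%N -> 0 <= c -> 0 < dl -> dl <= 1 ->
  `|1 - eps| <= c * (1 - dl) ^+ 2 -> c * (1 + dl) ^+ 2 <= 1 + eps ->
  0 <= s -> s * k = c ^+ r ->
  (1 - dl) * (k * u) <= f <= (1 + dl) * (k * u) ->
  (1 - dl) ^+ r <= u <= (1 + dl) ^+ r ->
  (1 - eps) ^+ r <= s * f <= (1 + eps) ^+ r.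
Proof.
move=> r0 c0 dl0 dl1 lo hi s0 sk /andP[flo fhi] /andP[ulo uhi].
have [elo ehi] := expr_bounds r0 c0 dl0 dl1 lo hi.
have skE d : s * (d * (k * u)) = c ^+ r * (d * u) by rewrite -sk; ring.
have cr0 : 0 <= c ^+ r by rewrite exprn_ge0.
apply/andP; split.
  apply: le_trans elo (le_trans _ (ler_wpM2l s0 flo)); rewrite skE.
  by apply: ler_wpM2l => //; apply: ler_wpM2l ulo; rewrite subr_ge0.
apply: le_trans (le_trans (ler_wpM2l s0 fhi) _) ehi; rewrite skE.
by apply: ler_wpM2l => //; apply: ler_wpM2l uhi; lra.
Qed.

Lemma construction_mono P (Post1 Post2 : nat -> memory -> Prop) :
  (forall n M, (1 < n)%N -> Post1 n M -> Post2 n M) ->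
  constructs_in_polytime P Post1 -> constructs_in_polytime P Post2.
Proof.
move=> le [c [d ok]]; exists c, d => n n1.
have [t [M [ex tle post]]] := ok n n1.
by exists t, M; split=> //; apply: le.
Qed.

(** * The two families of forms *)

Lemma sums_of_powers (R : realType) (r : nat) (eps : R) :
  (0 < r)%N -> 0 < eps ->
  exists2 kappa : R, 0 <= kappa & exists P : program,
    constructs_in_polytime P (fun n M =>
       let k := output_number M in
       let l (i : 'I_k) : 'rV[R]_n -> R := output_form M i in
       k%:R <= kappa * ln (n%:R : R) /\
       exists h : {ffun 'I_n -> 'I_r.+1} -> R,
         (forall x : 'rV[R]_n,
            \sum_(i < k) l i x ^+ r =
            \sum_(a : {ffun 'I_n -> 'I_r.+1} | (\sum_(m < n) a m)%N == r)
               h a * \prod_(m < n) x 0 m ^+ a m) /\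
         (forall a : {ffun 'I_n -> 'I_r.+1}, (\sum_(m < n) a m)%N = r ->
            (1 - eps) ^+ r <= h a <= (1 + eps) ^+ r)).
Proof.
move=> r0 eps0; have [p [q [dl [q0 dl0 dl1 lo hi]]]] := scale_choice eps0.
have [tbl [w [Q0 w0 moments]]] := exponential_table r dl0 dl1.
set Q := size tbl in Q0; have [D [B [D0 B0 Ddl Bge]]] := accuracy_parameters r0 Q0 dl0.
pose A := column_factor r B; pose Z := (q * w * (r`! * B))%N.
have Z0 : (0 < Z)%N by rewrite !muln_gt0 q0 w0 fact_gt0.
have [P HP] := construction R 1 [seq (p * x)%N | x <- tbl] r0 Q0 D0 Z0 Bge.
exists (A%:R * 2 ^+ r / ln 2).
  by rewrite divr_ge0 ?mulr_ge0 ?exprn_ge0 ?ln_ge0 ?ler1n.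
exists P; apply: construction_mono HP => n M n1 [M0 T0 [g [good entries]]] k l.
rewrite /= -/(output_number M) -/k in M0; split.
  by rewrite M0; apply: columns_le_ln.
pose y (i : nat) (m : nat) := output_entry R M (i * n + m).
exists (fun a : {ffun 'I_n -> 'I_r.+1} =>
  \sum_(i < k) r`!%:R * \prod_(m < n) (y i m ^+ a m / (a m)`!%:R)).
split=> [x|a sum_a].
  under eq_bigr do rewrite /l /output_form multinomial mulr_sumr.
  rewrite exchange_big; apply: eq_bigr => a _; rewrite mulr_suml.
  apply: eq_bigr => i _; rewrite -mulrA -big_split /=; congr (_ * _).
  by apply: eq_bigr => m _; rewrite exprMn mulrAC.
pose X x : R := (nth 0%N tbl x)%:R / w%:R.
have X0 x : 0 <= X x by rewrite divr_ge0.
pose c : R := p%:R / q%:R; pose T := root_log r n.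
pose theta := c / (T * (r`! * B))%:R.
have yE (i : 'I_k) (m : 'I_n) : y i m = theta * X (digit Q (g m) i).
  have ik : (i < columns r A n)%N by rewrite -M0.
  have := entries i 0%N m ik isT (ltn_ord m); rewrite muln1 addn0 mul0n add0n.
  rewrite -/(y i m) => ->; rewrite (nth_map 0%N) ?ltn_mod // /theta /c /X /Z.
  rewrite !natrM; field.
  by rewrite !pnatr_eq0 -!lt0n q0 w0 fact_gt0 B0 T0.
pose mean := \prod_(m < n) moment R tbl w (a m).
pose fact_a : R := \prod_(m < n) (a m)`!%:R.
have fact_a0 : 0 < fact_a by apply: prodr_gt0 => m _; rewrite ltr0n fact_gt0.
set F := \sum_(i < k) \prod_(m < n) X (digit Q (g m) i) ^+ a m.
have -> : \sum_(i < k) r`!%:R * \prod_(m < n) (y i m ^+ a m / (a m)`!%:R) =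
    r`!%:R * theta ^+ r * (F / fact_a).
  rewrite -mulr_sumr -mulrA; congr (_ * _); rewrite mulrA mulr_sumr mulr_suml.
  apply: eq_bigr => i _; rewrite prodf_div; congr (_ / _).
  by under eq_bigr do rewrite yE exprMn; rewrite big_split /= prodrXr sum_a.
rewrite -M0 in good.
have := agree_average Q0 D0 X0 good sum_a (erefl _).
rewrite -/F -/mean => dist.
(* Coordinate m contributes an error factor of exponent [a m], and these exponents add up to r. *)
have mean_a : (1 - dl) ^+ r <= mean / fact_a <= (1 + dl) ^+ r.
  have le_r m : (a m <= r)%N by rewrite -ltnS.
  rewrite -sum_a -!prodrXr /mean /fact_a -prodf_div.
  apply/andP; split; apply: ler_prod => m _; have /andP[mlo mhi] := moments _ (le_r m).
    rewrite exprn_ge0 ?subr_ge0 //= ler_pdivlMr ?ltr0n ?fact_gt0 //.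
    by rewrite mulrC.
  rewrite divr_ge0 ?ler0n //=; last first.
    by apply: le_trans mlo; rewrite mulr_ge0 // exprn_ge0 // subr_ge0.
  by rewrite ler_pdivrMr ?ltr0n ?fact_gt0 // mulrC.
have mean0 : 0 <= mean.
  rewrite -[mean](divfK (lt0r_neq0 fact_a0)); apply: mulr_ge0; last exact: ltW.
  by case/andP: mean_a => lo_a _; apply: le_trans lo_a; rewrite exprn_ge0 // subr_ge0.
have F_bounds := relative_error (mulr_ge0 (ler0n R k) mean0) Ddl dist.
have {}F_bounds : (1 - dl) * (k%:R * (mean / fact_a)) <= F / fact_a <=
    (1 + dl) * (k%:R * (mean / fact_a)).
  by rewrite !(mulrA _ mean) !(mulrA _ _ fact_a^-1) !ler_pM2r ?invr_gt0.
apply: (scaled_bounds (dl := dl) (c := c) (k := k%:R) (u := mean / fact_a) r0) => //.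
- by rewrite divr_ge0.
- by rewrite mulr_ge0 // exprn_ge0 // mulr_ge0 ?invr_ge0 // divr_ge0.
by rewrite M0 /columns; apply: normalisation.
Qed.

Lemma sums_of_products (R : realType) (r : nat) (eps : R) :
  (0 < r)%N -> 0 < eps ->
  exists2 kappa : R, 0 <= kappa & exists P : program,
    constructs_in_polytime P (fun n M =>
       let k := output_number M in
       let l (i : 'I_k) (j : 'I_r) : 'rV[R]_n -> R :=
         output_form M (i * r + j)%N in
       k%:R <= kappa * ln (n%:R : R) /\
       exists e : {set 'I_n} -> R,
         (forall x : 'rV[R]_n,
            \sum_(i < k) \prod_(j < r) l i j x =
            \sum_(I : {set 'I_n} | #|I| == r) e I * \prod_(i in I) x 0 i) /\
         (forall I : {set 'I_n}, #|I| = r ->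
            (1 - eps) ^+ r <= e I <= (1 + eps) ^+ r)).
Proof.
move=> r0 eps0; have [p [q [dl [q0 dl0 dl1 lo hi]]]] := scale_choice eps0.
have [D [B [D0 B0 Ddl Bge]]] := accuracy_parameters r0 r0 dl0.
pose A := column_factor r B; pose Z := (q * (r`! * B))%N.
have Z0 : (0 < Z)%N by rewrite !muln_gt0 q0 fact_gt0.
(* Row j is nonzero at letter j only. The extra factor r in each form offsets the frequency r^(-r)
   with which r given words show r prescribed letters. *)
pose tbl := mkseq (fun y => if y %/ r == y %% r then p * r else 0)%N (r * r).
have [P HP] := construction R r tbl r0 r0 D0 Z0 Bge.
exists (A%:R * 2 ^+ r / ln 2).
  by rewrite divr_ge0 ?mulr_ge0 ?exprn_ge0 ?ln_ge0 ?ler1n.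
exists P; apply: construction_mono HP => n M n1 [M0 T0 [g [good entries]]] k l.
rewrite /= -/(output_number M) -/k in M0; split.
  by rewrite M0; apply: columns_le_ln.
rewrite -M0 in good entries.
pose y (i j m : nat) := output_entry R M ((i * r + j) * n + m).
pose c : R := p%:R / q%:R; pose T := root_log r n.
pose theta := c / (T * (r`! * B))%:R.
have yE (i : 'I_k) (j : 'I_r) (m : 'I_n) :
    y i j m = theta * r%:R * (digit r (g m) i == j)%:R.
  rewrite /y entries // /tbl nth_mkseq; last first.
    have := ltn_ord j; have : (digit r (g m) i < r)%N by rewrite ltn_mod.
    by nia.
  have dr : (digit r (g m) i < r)%N by rewrite ltn_mod.
  rewrite divnMDl // divn_small // addn0 modnMDl modn_small // eq_sym.
  case: eqP => _ /=; last by rewrite mulr0 mul0r.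
  rewrite /theta /c /Z !natrM; field.
  by rewrite !pnatr_eq0 -!lt0n q0 fact_gt0 B0 T0.
pose inj_onto (I : {set 'I_n}) (f : {ffun 'I_r -> 'I_n}) :=
  injectiveb f && ([set f j | j in 'I_r] == I).
exists (fun I => \sum_(i < k) \sum_(f | inj_onto I f) \prod_(j < r) y i j (f j)).
split=> [x|I cI].
  under eq_bigr do rewrite /l /output_form bigA_distr_bigA /=.
  under [RHS]eq_bigr do rewrite mulr_suml.
  rewrite [RHS]exchange_big; apply: eq_bigr => i _.
  rewrite (bigID (fun f : {ffun 'I_r -> 'I_n} => injectiveb f)) /=.
  (* A coordinate has one letter per column, so it cannot occur in two forms of that column:
     repeated variables cancel. *)
  rewrite [X in _ + X]big1 ?addr0 => [|f /injectivePn[j [j' jj' fjj']]]; last first.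
    rewrite (bigD1 j) //= (bigD1 j') 1?eq_sym //= -/(y i j _) -/(y i j' _) !yE.
    rewrite -fjj'; case: (eqVneq (digit r (g (f j)) i) j) => [->|_]; last first.
      by rewrite mulr0 !mul0r.
    by rewrite (inj_eq val_inj) (negbTE jj') mulr0 mul0r mul0r mulr0.
  rewrite (partition_big (fun f : {ffun 'I_r -> 'I_n} => [set f j | j in 'I_r])
    (fun I => #|I| == r)) /=; last first.
    by move=> f /injectiveP finj; rewrite card_imset // card_ord.
  apply: eq_bigr => I _; rewrite mulr_suml; apply: eq_bigr => f.
  move=> /andP[/injectiveP finj /eqP <-].
  rewrite big_imset /=; last by move=> j j' _ _; apply: finj.
  by rewrite big_split.
(* The inverse of [f] on its image [I]: the letters that the words of [I] must show for the term of
   [f] to survive. *)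
pose fi (f : {ffun 'I_r -> 'I_n}) (m : 'I_n) : 'I_r :=
  odflt (Ordinal r0) [pick j | f j == m].
have prodE (f : {ffun 'I_r -> 'I_n}) : inj_onto I f ->
    \sum_(i < k) \prod_(j < r) y i j (f j) =
    theta ^+ r * (r%:R ^+ r * (agree k g I (fi f))%:R).
  move=> /andP[/injectiveP finj /eqP imf].
  have fiK j : fi f (f j) = j.
    by rewrite /fi; case: pickP => [j' /eqP/finj //|/(_ j)]; rewrite eqxx.
  rewrite mulrA -exprMn /agree natr_sum mulr_sumr; apply: eq_bigr => i _.
  under eq_bigr do rewrite yE; rewrite big_split prodr_const card_ord /=.
  rewrite -natr_forall; congr (_ * _%:R); congr nat_of_bool.
  apply/forallP/forall_inP => [ok m|ok j].
    by rewrite -imf => /imsetP[j _ ->]; rewrite fiK.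
  by have := ok (f j); rewrite fiK; apply; rewrite -imf imset_f.
have card_f : #|inj_onto I| = r`!.
  have := card_inj_ffuns_on 'I_r (mem I); rewrite cI card_ord ffactnn cardsE => <-.
  apply: eq_card => f; rewrite [f \in inj_onto I]unfold_in [RHS]inE andbC.
  case: injectiveP => finj; rewrite ?andbF //.
  rewrite !andbT; apply/eqP/ffun_onP => [<- j|fI]; first exact: imset_f.
  apply/eqP; rewrite eqEcard card_imset // card_ord cI leqnn andbT.
  by apply/subsetP => _ /imsetP[j _ ->]; apply: fI.
rewrite exchange_big /= (eq_bigr _ prodE) -mulr_sumr.
set S := \sum_(f | inj_onto I f) _.
have f0 : 0 < r`!%:R :> R by rewrite ltr0n fact_gt0.
have S_bounds : (1 - dl) * (k%:R * 1) <= S / r`!%:R <= (1 + dl) * (k%:R * 1).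
  have term f : (1 - dl) * k%:R <= r%:R ^+ r * (agree k g I (fi f))%:R <= (1 + dl) * k%:R.
    apply: relative_error Ddl _ => //.
    have := agree_bound R (fi f) r0 D0 good (eq_leq cI); rewrite cI.
    by rewrite mulrAC.
  have cst (x : R) : \sum_(f | inj_onto I f) x = x * r`!%:R.
    by rewrite sumr_const card_f mulr_natr.
  rewrite mulr1 ler_pdivlMr // ler_pdivrMr // -!cst.
  by apply/andP; split; apply: ler_sum => f _; case/andP: (term f).
have -> : theta ^+ r * S = r`!%:R * theta ^+ r * (S / r`!%:R).
  rewrite (mulrC r`!%:R) -mulrA; congr (_ * _).
  by rewrite [RHS]mulrC divfK // gt_eqF.
apply: (scaled_bounds (dl := dl) (c := c) (k := k%:R) (u := 1) r0) => //.
- by rewrite divr_ge0.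
- by rewrite mulr_ge0 // exprn_ge0 // mulr_ge0 ?invr_ge0 // divr_ge0.
- by rewrite M0 /columns; apply: normalisation.
rewrite exprn_ile1 ?subr_ge0 //; last by lra.
by rewrite exprn_ege1 //; lra.
Qed.

Theorem mainTheorem7 (R : realType) (r : nat) (eps : R)
    (r_gt0 : (0 < r)%N) (eps_gt0 : 0 < eps) :
  exists kappa : R, 0 < kappa /\
    (exists P : program, constructs_in_polytime P (fun n M =>
       let k := output_number M in
       let l (i : 'I_k) : 'rV[R]_n -> R := output_form M i in
       k%:R <= kappa * ln (n%:R : R) /\
       exists h : {ffun 'I_n -> 'I_r.+1} -> R,
         (forall x : 'rV[R]_n,
            \sum_(i < k) l i x ^+ r =
            \sum_(a : {ffun 'I_n -> 'I_r.+1} | (\sum_(m < n) a m)%N == r)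
               h a * \prod_(m < n) x 0 m ^+ a m) /\
         (forall a : {ffun 'I_n -> 'I_r.+1}, (\sum_(m < n) a m)%N = r ->
            (1 - eps) ^+ r <= h a <= (1 + eps) ^+ r))) /\
    (exists P : program, constructs_in_polytime P (fun n M =>
       let k := output_number M in
       let l (i : 'I_k) (j : 'I_r) : 'rV[R]_n -> R :=
         output_form M (i * r + j)%N in
       k%:R <= kappa * ln (n%:R : R) /\
       exists e : {set 'I_n} -> R,
         (forall x : 'rV[R]_n,
            \sum_(i < k) \prod_(j < r) l i j x =
            \sum_(I : {set 'I_n} | #|I| == r) e I * \prod_(i in I) x 0 i) /\
         (forall I : {set 'I_n}, #|I| = r ->
            (1 - eps) ^+ r <= e I <= (1 + eps) ^+ r))).
Proof.
have [ka ka0 [Pa HPa]] := sums_of_powers r_gt0 eps_gt0.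
have [kb kb0 [Pb HPb]] := sums_of_products r_gt0 eps_gt0.
have ln0 n : (1 < n)%N -> 0 <= ln n%:R :> R by move=> n1; rewrite ln_ge0 // ler1n (ltnW n1).
exists (ka + kb + 1); split; first by rewrite ltr_wpDl ?addr_ge0.
split; [exists Pa; apply: construction_mono HPa | exists Pb; apply: construction_mono HPb];
  move=> n M n1 [le_k rest]; split=> //; apply: le_trans le_k _;
  by apply: ler_wpM2r; rewrite ?ln0 //; lra.
Qed.
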